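(* Every element of $$\mathfrak{so}(n,\mathbb{C})_{\Theta}:=\{x\in\mathfrak{so}(n,\mathbb{C}):\sigma(x_i)\cap\sigma(x_{i+1})=\emptyset\text{ for } i=2,\dots,n-1\}$$ is strongly regular.
   Context: Let $\mathfrak{g}=\mathfrak{so}(n,\mathbb{C})$ (for a nondegenerate symmetric bilinear form on $\mathbb{C}^n$) and consider the chain $\mathfrak{g}_1\subset\mathfrak{g}_2\subset\dots\subset\mathfrak{g}_n=\mathfrak{g}$ with $\mathfrak{g}_i=\mathfrak{so}(i,\mathbb{C})$, where $\mathfrak{so}(i,\mathbb{C})\subset\mathfrak{so}(i+1,\mathbb{C})$ is the annihilator of a non-isotropic vector (equivalently, there is a chain of nondegenerate subspaces $V_1\subset\dots\subset V_n=\mathbb{C}^n$, $\dim V_i=i$, and $\mathfrak{g}_i$ consists of the elements of $\mathfrak{g}$ annihilating $V_i^\perp$). Let $G_i=SO(i,\mathbb{C})$ be the corresponding connected group, $r_i=\lfloor i/2\rfloor$ the rank of $\mathfrak{g}_i$, $\pi_i:\mathfrak{g}\to\mathfrak{g}_i$ the projection along $\mathfrak{g}_i^\perp$ (with respect to the trace form), and $x_i=\pi_i(x)$, regarded as an element of $\mathfrak{so}(i,\mathbb{C})$. For $y\in\mathfrak{so}(m,\mathbb{C})$, the spectrum $\sigma(y)$ is the multiset of eigenvalues of $y$ (as an $m\times m$ matrix), except that if $m$ is odd one occurrence of the eigenvalue $0$ is omitted (if $0$ has multiplicity $2j+1$ it is listed $2j$ times). Let $\psi_{i,1},\dots,\psi_{i,r_i}$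 be algebraically independent generators of $\mathbb{C}[\mathfrak{g}_i]^{G_i}$, and $f_{i,j}=\pi_i^*\psi_{i,j}$. An element $x\in\mathfrak{g}$ is strongly regular if the differentials $\{df_{i,j}(x): i=1,\dots,n;\ j=1,\dots,r_i\}\subset T^*_x(\mathfrak{g})$ are linearly independent. *)

(* Defs.v *)
From HB Require Import structures.
From mathcomp Require Export all_boot all_order all_algebra.
From mathcomp Require Export sesquilinear reals complex mpoly.

Set Implicit Arguments.
Unset Strict Implicit.
Unset Printing Implicit Defensive.

Import GRing.Theory.
Local Open Scope ring_scope.

(* Vectors are rows and matrices act on them on the right.  The bilinear form *)
(* with Gram matrix B is (u, v) |-> u *m B *m v^T; subspaces of F^n are row   *)
(* spaces, and orthomx idfun B W is the B-orthogonal complement of W.         *)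

Section OrthogonalLieAlgebra.
Variables (F : fieldType) (n : nat).
Implicit Types (B V W x y g : 'M[F]_n) (U : {vspace 'M[F]_n}).

Definition so B : {vspace 'M[F]_n} :=
  lker (linfun (mulmxr B) + (linfun (mulmx B) \o linfun trmx))%VF.

Lemma mem_so B x : (x \in so B) = (x *m B + B *m x^T == 0).
Proof. by rewrite memv_ker add_lfunE comp_lfunE !lfunE. Qed.

Definition nondegenerate_subspace B W : Prop :=
  (W :&: orthomx idfun B W :=: (0 : 'M[F]_n))%MS.

Definition nondegenerate_chain B (V : nat -> 'M[F]_n) : Prop :=
  (forall i, (1 <= i <= n)%N ->
     \rank (V i) = i /\ nondegenerate_subspace B (V i)) /\
  (forall i, (1 <= i < n)%N -> (V i <= V i.+1)%MS).

(* The elements of so B annihilating the orthogonal complement of W, i.e. the *)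
(* copy of so(W) inside so B.                                                 *)
Definition so_sub B W : {vspace 'M[F]_n} :=
  (so B :&: lker (linfun (mulmx (orthomx idfun B W))))%VS.

Lemma mem_so_sub B W x :
  (x \in so_sub B W) = (x \in so B) && (orthomx idfun B W *m x == 0).
Proof. by rewrite memv_cap memv_ker lfunE. Qed.

(* The connected group SO(W), acting trivially on the complement of W.        *)
Definition SO_sub B W g : Prop :=
  [/\ g *m B *m g^T = B, \det g = 1
    & orthomx idfun B W *m g = orthomx idfun B W].

Definition trace_form z y : F^o := \tr (y *m z).

Fact trace_form_is_linear z : linear (trace_form z).
Proof.
by move=> a u v; rewrite /trace_form mulmxDl -scalemxAl linearD linearZ.
Qed.

HB.instance Definition _ z :=
  GRing.isLinear.Build F 'M[F]_n F^o *:%R (trace_form z)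
    (trace_form_is_linear z).

(* Orthogonal complement of U in so B for the trace form.                     *)
Definition trace_orth B U : {vspace 'M[F]_n} :=
  (so B :&: \bigcap_(z <- vbasis U) lker (linfun (trace_form z)))%VS.

Lemma mem_trace_orth B U y :
  reflect (y \in so B /\ forall z, z \in U -> \tr (y *m z) = 0)
          (y \in trace_orth B U).
Proof.
rewrite memv_cap; apply: (iffP andP) => -[yso yU]; split=> //.
  have {}yU : forall z, z \in (vbasis U : seq _) -> \tr (y *m z) = 0.
    move=> z; elim: (vbasis U : seq _) yU => // a s IHs.
    rewrite big_cons memv_cap memv_ker lfunE /= => /andP[/eqP ya ys].
    by rewrite inE => /predU1P[->|] //; apply: IHs.
  move=> z /coord_vbasis->; rewrite mulmx_sumr raddf_sum big1 //= => i _.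
  by rewrite -scalemxAr mxtraceZ yU ?mulr0 // mem_nth // size_tuple.
have {}yU : forall z, z \in (vbasis U : seq _) -> \tr (y *m z) = 0.
  by move=> z /vbasis_mem /yU.
elim: (vbasis U : seq _) yU => [|a s IHs] yU; first by rewrite big_nil memvf.
rewrite big_cons memv_cap memv_ker lfunE /= /trace_form yU ?mem_head // eqxx IHs // => z zs.
by apply: yU; rewrite inE zs orbT.
Qed.

(* The projection of so B onto so_sub B W along its trace-form complement.    *)
Definition so_proj B W : 'End('M[F]_n) :=
  daddv_pi (so_sub B W) (trace_orth B (so_sub B W)).

(* Polynomial functions on a subspace U of 'M_n are represented by            *)
(* polynomials in the n * n matrix entries, two of them being identified when *)
(* they agree on U.                                                           *)
Definition peval (p : {mpoly F[n * n]}) x : F := p.@[mxvec x 0].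

Definition pullback (L : 'End('M[F]_n)) (p : {mpoly F[n * n]}) :
    {mpoly F[n * n]} :=
  p \mPo [tuple \sum_(l < n * n) lin_mx L l k *: 'X_l | k < n * n].

Lemma pullbackE L p x : peval (pullback L p) x = peval p (L x).
Proof.
rewrite /peval /pullback comp_mpoly_meval; apply: meval_eq => k.
rewrite -mul_vec_lin tnth_map tnth_ord_tuple raddf_sum mxE.
by apply: eq_bigr => l _; rewrite /= mevalZ mevalXU mulrC.
Qed.

Definition SO_invariant B W (p : {mpoly F[n * n]}) : Prop :=
  forall g y, SO_sub B W g -> y \in so_sub B W ->
    peval p (g *m y *m invmx g) = peval p y.

(* psi is a system of algebraically independent generators of the algebra of  *)
(* SO(W)-invariant polynomial functions on so_sub B W.                        *)
Definition invariant_generators B W (r : nat)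
    (psi : 'I_r -> {mpoly F[n * n]}) : Prop :=
  [/\ forall j, SO_invariant B W (psi j),
      forall p, SO_invariant B W p ->
        exists P : {mpoly F[r]}, forall y, y \in so_sub B W ->
          peval p y = P.@[fun j => peval (psi j) y]
    & forall P : {mpoly F[r]},
        (forall y, y \in so_sub B W -> P.@[fun j => peval (psi j) y] = 0) ->
        P = 0].

(* The differential at x of the restriction of p to U, as a linear form on    *)
(* the tangent space T_x(U) = U.                                              *)
Definition differential_fun U (p : {mpoly F[n * n]}) x (v : subvs_of U) : F^o :=
  \sum_(k < n * n) (p^`M(k)).@[mxvec x 0] * mxvec (vsval v) 0 k.

Fact differential_is_linear U p x : linear (@differential_fun U p x).
Proof.
move=> a u v; rewrite /differential_fun scaler_sumr -big_split /=.
apply: eq_bigr => k _; rewrite !linearP !mxE mulrDr mulrCA; congr (_ + _).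
Qed.

HB.instance Definition _ U p x :=
  GRing.isLinear.Build F (subvs_of U) F^o *:%R (@differential_fun U p x)
    (@differential_is_linear U p x).

Definition differential U (p : {mpoly F[n * n]}) x : 'Hom(subvs_of U, F^o) :=
  linfun (@differential_fun U p x).

Definition strongly_regular B (V : nat -> 'M[F]_n)
    (psi : forall i : nat, 'I_i./2 -> {mpoly F[n * n]}) x : bool :=
  free [seq differential (so B) (pullback (so_proj B (V i)) (psi i j)) x
       | i <- iota 1 n, j <- enum 'I_i./2].

End OrthogonalLieAlgebra.

Section Spectrum.
Variable F : closedFieldType.

(* Eigenvalues listed with algebraic multiplicity.                            *)
Definition eigenvalues m (A : 'M[F]_m) : seq F :=
  sval (closed_field_poly_normal (char_poly A)).

Lemma eigenvaluesP m (A : 'M[F]_m) :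
  char_poly A = \prod_(a <- eigenvalues A) ('X - a%:P).
Proof.
rewrite /eigenvalues; case: closed_field_poly_normal => s /= {1}->.
by rewrite (monicP (char_poly_monic A)) scale1r.
Qed.

Definition spectrum m (A : 'M[F]_m) : seq F :=
  if odd m then rem 0 (eigenvalues A) else eigenvalues A.

(* x_i as an endomorphism of W = V_i: the size of this matrix is \rank W.     *)
Definition so_part n (B W x : 'M[F]_n) : 'M[F]_(\rank W) :=
  restrictmx W (so_proj B W x).

Definition so_Theta n (B : 'M[F]_n) (V : nat -> 'M[F]_n) (x : 'M[F]_n) : Prop :=
  x \in so B /\
  forall i, (2 <= i < n)%N ->
    forall a, ~~ ((a \in spectrum (so_part B (V i) x)) &&
                  (a \in spectrum (so_part B (V i.+1) x))).

End Spectrum.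

(* Main.v *)
From HB Require Import structures.
From mathcomp Require Import fingroup perm zify.
Require Import Defs.

Set Implicit Arguments.
Unset Strict Implicit.
Unset Printing Implicit Defensive.

Import Order.TTheory GRing.Theory Num.Theory.
Local Open Scope ring_scope.

(** Put [y i := P_i x P_i] for the component of [x] in so(V_i).  The family psi_i generates
    the invariants, so by the chain rule the differentials of any [i./2] invariants
    lie in the span of those of psi_i; if the former are independent, so are the latter,
    and the two spans agree.  It is therefore enough to exhibit good invariants: the traces
    of even powers, the last one being replaced by the Pfaffian when [i] is even and
    [y i] is singular.  Their gradients, the odd powers of [y i] and a matrix [M] with
    [M (y i) = (y i) M = 0], commute with [y i].

    The spectral condition makes any [y i.+1]-stable subspace of V_i at most
    one-dimensional: the characteristic polynomial of [y i.+1] on it divides those of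
    [y i] and [y i.+1], and two common roots would survive the removal of one
    zero.  Consequently the powers of [y i.+1] of exponent at most [i - 1] are
    independent and its corank is at most 2, so the invariants above have independent
    gradients; and an element of so(V_i) commuting with [y i.+1] has a stable image in
    V_i, of rank at most 1, hence vanishes by skewness.  This last fact separates the
    level [i.+1] from the lower ones. *)

(** * Pfaffians *)

Section Pfaffian.
Variable R : comNzRingType.

(** One matrix argument for each pair of indices $i$, $r+i$: [pf] is the diagonal of this form,
    which can be manipulated one argument at a time. Without division it makes sense over the
    integers and over polynomial rings. *)
Definition pairing r (A : 'I_r -> 'M[R]_(r + r)) : R :=
  \sum_(s : 'S_(r + r)) (-1) ^+ s *
     \prod_(i < r) A i (s (lshift r i)) (s (rshift r i)).

(* On skew matrices this is, up to sign, 2 ^ r * r! times the usual Pfaffian. *)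
Definition pf r (A : 'M[R]_(r + r)) : R := pairing (fun=> A).

Lemma eq_pairing r (A A' : 'I_r -> 'M[R]_(r + r)) :
  A =1 A' -> pairing A = pairing A'.
Proof.
by move=> eA; apply: eq_bigr => s _; congr (_ * _); apply: eq_bigr => i _; rewrite eA.
Qed.

(** Expanding all entries of $gAg^T$ gives a sum over index functions $f$. Summing over [s] turns
    the $g$-part into a determinant with rows selected by $f$, which vanishes unless $f$ is a
    permutation. *)
Lemma pfM r (g A : 'M[R]_(r + r)) : pf (g *m A *m g^T) = \det g * pf A.
Proof.
pose h (f : {ffun 'I_(r + r) -> 'I_(r + r)}) : R :=
  \prod_(i < r) A (f (lshift r i)) (f (rshift r i)).
have expand (s : 'S_(r + r)) :
    \prod_(i < r) (g *m A *m g^T) (s (lshift r i)) (s (rshift r i))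
  = \sum_(f : {ffun 'I_(r + r) -> 'I_(r + r)})
       h f * \prod_i g (s i) (f i).
  transitivity (\prod_(i < r) \sum_(kl : 'I_(r + r) * 'I_(r + r))
     (A kl.1 kl.2 * (g (s (lshift r i)) kl.1 * g (s (rshift r i)) kl.2))).
    apply: eq_bigr => i _; rewrite mxE.
    rewrite -(pair_bigA _ (fun k l => A k l *
      (g (s (lshift r i)) k * g (s (rshift r i)) l))) exchange_big /=.
    apply: eq_bigr => l _; rewrite !mxE mulr_suml; apply: eq_bigr => k _.
    by rewrite mulrCA mulrA.
  rewrite bigA_distr_bigA /=.
  (* An $r$-tuple of pairs of indices is the same as a function on the $2r$ indices. *)
  pose split2 (p : {ffun 'I_r -> 'I_(r + r) * 'I_(r + r)}) :
      {ffun 'I_(r + r) -> 'I_(r + r)} :=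
    [ffun i => match split i with inl j => (p j).1 | inr j => (p j).2 end].
  pose join2 (f : {ffun 'I_(r + r) -> 'I_(r + r)}) : {ffun 'I_r -> _} :=
    [ffun i => (f (lshift r i), f (rshift r i))].
  have sl p i : split2 p (lshift r i) = (p i).1.
    by rewrite ffunE (unsplitK (inl i)).
  have sr p i : split2 p (rshift r i) = (p i).2.
    by rewrite ffunE (unsplitK (inr i)).
  rewrite [RHS](reindex split2) /=; last first.
    exists join2 => [p _|f _].
      by apply/ffunP => i; rewrite ffunE sl sr; case: (p i).
    apply/ffunP => i; rewrite -(splitK i).
    by case: (split i) => j /=; rewrite ?sl ?sr ffunE.
  apply: eq_bigr => p _; rewrite big_split /=; congr (_ * _).
    by apply: eq_bigr => i _; rewrite sl sr.
  rewrite big_split /= big_split_ord /=.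
  by congr (_ * _); apply: eq_bigr => i _; rewrite ?sl ?sr.
rewrite /pf /pairing.
under eq_bigr => s _ do rewrite expand mulr_sumr.
rewrite exchange_big /=.
have inner f : \sum_(s : 'S_(r + r)) (-1) ^+ s * (h f * \prod_i g (s i) (f i))
    = h f * \det (\matrix_(i, j) g j (f i)).
  rewrite mulr_sumr; apply: eq_bigr => s _; rewrite mulrCA; congr (_ * (_ * _)).
  by apply: eq_bigr => i _; rewrite mxE.
under eq_bigr do rewrite inner.
rewrite (bigID (fun f : {ffun 'I_(r + r) -> 'I_(r + r)} => injectiveb f)) /= addrC.
rewrite big1 ?add0r; last first.
  move=> f /injectivePn [i [j neij eqf]].
  by rewrite (determinant_alternate neij) ?mulr0 // => k; rewrite !mxE eqf.
rewrite (reindex (@pval _)) /=; last first.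
  pose in_Sn := insubd (1%g : 'S_(r + r)).
  by exists in_Sn => /= f Uf; first apply: val_inj; apply: insubdK.
rewrite mulr_sumr; apply: eq_big => [s|s _]; first by rewrite (valP s).
have -> : (\matrix_(i, j) g j (pval s i)) = row_perm s g^T.
  by apply/matrixP => i j; rewrite !mxE pvalE.
rewrite row_permE det_mulmx det_perm det_tr mulrC -mulrA [RHS]mulrCA.
by congr (_ * (_ * _)); apply: eq_bigr => i _; rewrite pvalE.
Qed.

(** The sum is reindexed by the transposition of $i$ and $r+i$, which reverses all signs. *)
Lemma pairing_trmx r (A A' : 'I_r -> 'M[R]_(r + r)) (i : 'I_r) :
  A' i = (A i)^T -> (forall j, j != i -> A' j = A j) ->
  pairing A' = - pairing A.
Proof.
move=> Ai Aj; rewrite /pairing -sumrN.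
pose t := tperm (lshift r i) (rshift r i).
rewrite (reindex_inj (mulgI t)) /=; apply: eq_bigr => s _.
rewrite odd_permM odd_tperm eq_lrshift addTb signrN mulNr.
congr (- (_ * _)); apply: eq_bigr => j _.
rewrite !permM; have [->|neq] := eqVneq j i.
  by rewrite /t tpermL tpermR Ai mxE.
by rewrite Aj // /t !tpermD // ?eq_lrshift ?eq_rlshift // ?eq_lshift ?eq_rshift //
  eq_sym.
Qed.

Lemma pairingD r (A A1 A2 : 'I_r -> 'M[R]_(r + r)) (i : 'I_r) :
  A i = A1 i + A2 i -> (forall j, j != i -> A1 j = A j /\ A2 j = A j) ->
  pairing A = pairing A1 + pairing A2.
Proof.
move=> Ai Aj; rewrite /pairing -big_split /=; apply: eq_bigr => s _.
rewrite -mulrDr; congr (_ * _).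
rewrite (bigD1 i) //= [in RHS](bigD1 i) //= [X in _ + X](bigD1 i) //= Ai mxE mulrDl.
by congr (_ * _ + _ * _); apply: eq_bigr => j /Aj[e1 e2]; rewrite ?e1 ?e2.
Qed.

(** By [pairing_trmx] an argument $-A^T$ counts as much as $A$, so each skew-symmetrization doubles
    the value. *)
Lemma pf_sub_trmx r (A : 'M[R]_(r + r)) : pf (A - A^T) = pf A *+ 2 ^ r.
Proof.
(* [T k] has its first [k] arguments skew-symmetrized. *)
pose T k := fun i : 'I_r => if (i < k)%N then A - A^T else A.
have step k : (k <= r)%N -> pairing (T k) = pf A *+ 2 ^ k.
  elim: k => [|k IHk] ltkr; first by rewrite mulr1n; apply: eq_pairing => i.
  pose i0 := Ordinal ltkr.
  pose T' := fun i : 'I_r => if i == i0 then - A^T else T k.+1 i.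
  have Tk i : i != i0 -> T k.+1 i = T k i.
    by rewrite /T ltnS [(i <= k)%N]leq_eqVlt -(inj_eq val_inj) /= => /negbTE->.
  have Tk0 : T k i0 = A by rewrite /T /= ltnn.
  rewrite (@pairingD _ (T k.+1) (T k) T' i0).
  - rewrite expnS mulnC mulrnA mulr2n -IHk 1?ltnW //; congr (_ + _).
    pose T2 := fun i : 'I_r => if i == i0 then - A else T k i.
    rewrite (@pairing_trmx _ T2 T' i0) /T' /T2 ?eqxx ?linearN //; last first.
      by move=> j nej; rewrite (negbTE nej) Tk.
    rewrite /pairing -sumrN; apply: eq_bigr => s _; rewrite -mulrN; congr (_ * _).
    rewrite (bigD1 i0) //= [in RHS](bigD1 i0) //= eqxx Tk0 mxE mulNr opprK.
    by congr (_ * _); apply: eq_bigr => j /negbTE->.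
  - by rewrite Tk0 /T' eqxx /T /= ltnSn.
  - by move=> j nej; rewrite /T' (negbTE nej) Tk.
by rewrite -(step r (leqnn r)); apply: eq_pairing => i; rewrite /T ltn_ord.
Qed.

End Pfaffian.

Lemma map_pf (R S : comNzRingType) (f : {rmorphism R -> S}) r (A : 'M[R]_(r + r)) :
  pf (map_mx f A) = f (pf A).
Proof.
rewrite /pf /pairing rmorph_sum; apply: eq_bigr => s _.
rewrite rmorphM rmorph_sign rmorph_prod; congr (_ * _).
by apply: eq_bigr => i _; rewrite mxE.
Qed.

(** The standard symplectic matrix is this one minus its transpose; nonnegative entries allow a
    positivity argument over the integers. *)
Definition symplectic_half (R : nzRingType) r : 'M[R]_(r + r) := block_mx 0 1%:M 0 0.
Definition symplectic (R : nzRingType) r : 'M[R]_(r + r) := block_mx 0 1%:M (- 1%:M) 0.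

(** Every term is nonnegative and the identity permutation contributes 1. *)
Lemma pf_half_gt0 r : 0 < pf (symplectic_half int r).
Proof.
have Elr i j : symplectic_half int r (lshift r i) (rshift r j) = (i == j)%:R.
  by rewrite block_mxEur mxE.
have Ell i (j : 'I_r) : symplectic_half int r i (lshift r j) = 0.
  by case: (split_ordP i) => k ->; rewrite ?block_mxEul ?block_mxEdl mxE.
have Er (i : 'I_r) j : symplectic_half int r (rshift r i) j = 0.
  by case: (split_ordP j) => k ->; rewrite ?block_mxEdr ?block_mxEdl mxE.
rewrite /pf /pairing (bigD1 1%g) //= odd_perm1 mul1r big1 ?ltr_wpDr //; last first.
  by move=> i _; rewrite !perm1 Elr eqxx.
(* A nonzero term comes from a permutation acting in the same way on both
   halves of the indices, whose sign is a square. *)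
apply: sumr_ge0 => s _.
have [/existsP[i /eqP Hi]|] := boolP [exists i : 'I_r, symplectic_half int r
  (s (lshift r i)) (s (rshift r i)) == 0].
  by rewrite (bigD1 i) //= Hi mul0r mulr0.
rewrite negb_exists => /forallP Hne.
have Hs i : exists k : 'I_r, s (lshift r i) = lshift r k /\ s (rshift r i) = rshift r k.
  move: (Hne i).
  case: (split_ordP (s (lshift r i))) => k ->; last by rewrite Er eqxx.
  case: (split_ordP (s (rshift r i))) => l ->; first by rewrite Ell eqxx.
  by rewrite Elr; case: (eqVneq k l) => [-> _|_]; [exists l | rewrite eqxx].
pose P : 'M[int]_r := \matrix_(i, j) (s (lshift r i) == lshift r j)%:R.
have Ps : perm_mx s = block_mx P 0 0 P.
  apply/matrixP => i j; rewrite !mxE.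
  case: (split_ordP i) => k ->; case: (split_ordP j) => l ->;
  rewrite ?mxE ?row_mxEl ?row_mxEr ?mxE ?(unsplitK (inl _)) ?(unsplitK (inr _)) //=;
  have [u [e1 e2]] := Hs k; rewrite ?e1 ?e2 ?mxE ?e1 ?eq_lrshift ?eq_rlshift
    ?eq_lshift ?eq_rshift //=.
apply: mulr_ge0.
  by rewrite -det_perm Ps det_lblock -expr2 sqr_ge0.
apply: prodr_ge0 => i _; have [k [-> ->]] := Hs i.
by rewrite Elr eqxx.
Qed.

(** In characteristic 0, both $2^r$ and the positive integer of [pf_half_gt0] stay nonzero. *)
Lemma pf_symplectic_neq0 (F : numFieldType) r : pf (symplectic F r) != 0.
Proof.
have -> : symplectic F r = symplectic_half F r - (symplectic_half F r)^T.
  by rewrite /symplectic_half tr_block_mx !trmx0 trmx1 opp_block_mx add_block_mx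
    !oppr0 !addr0 add0r.
rewrite pf_sub_trmx mulrn_eq0 expn_eq0 /=.
have -> : symplectic_half F r = map_mx intr (symplectic_half int r).
  by rewrite map_block_mx !map_mx0 map_scalar_mx rmorph1.
by rewrite map_pf intr_eq0 gt_eqF // pf_half_gt0.
Qed.

(** * Normal form of skew-symmetric matrices *)

Section SkewNormalForm.
Variable F : numFieldType.

Lemma skew_diag0 m (A : 'M[F]_m) k (u : 'M_(k, m)) i :
  A^T = - A -> (u *m A *m u^T) i i = 0.
Proof.
move=> skA; have : (u *m A *m u^T)^T = - (u *m A *m u^T).
  by rewrite !trmx_mul trmxK skA mulNmx mulmxN mulmxA.
move=> /(congr1 (fun M : 'M_k => M i i)); rewrite !mxE => /eqP.
by rewrite -addr_eq0 -mulr2n mulrn_eq0 /= => /eqP.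
Qed.

Lemma skew_mulmx_tr m (A : 'M[F]_m) k l (X : 'M_(k, m)) (Y : 'M_(l, m)) :
  A^T = - A -> X *m A *m Y^T = - (Y *m A *m X^T)^T.
Proof. by move=> skA; rewrite !trmx_mul trmxK skA mulNmx mulmxN opprK mulmxA. Qed.

(** Symplectic Gram-Schmidt: rows of [U] and [W] are hyperbolic pairs, and a new pair is found in
    their $A$-orthogonal complement. Asking only for rank $2r-1$ is what later yields evenness of
    the rank. *)
Lemma skew_pairs m (A : 'M[F]_m) r : A^T = - A -> ((r + r).-1 <= \rank A)%N ->
  exists U W : 'M[F]_(r, m),
    [/\ U *m A *m U^T = 0, W *m A *m W^T = 0 & U *m A *m W^T = 1%:M].
Proof.
move=> skA; elim: r => [|r IHr] le_r.
  by exists 0, 0; split; apply/matrixP=> -[].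
have /IHr [U [W [UU WW UW]]] : ((r + r).-1 <= \rank A)%N.
  by apply: leq_trans le_r; rewrite addSn addnS /= (leq_trans (leq_pred _)).
have skT k l (X : 'M_(k, m)) (Y : 'M_(l, m)) := skew_mulmx_tr X Y skA.
have WU : W *m A *m U^T = - 1%:M by rewrite skT UW trmx1.
(* Projection along the rows of [U] and [W] onto their $A$-orthogonal complement. *)
pose P : 'M[F]_m := 1%:M - A *m W^T *m U + A *m U^T *m W.
have PU : P *m A *m U^T = 0.
  rewrite /P !mulmxDl !mulNmx mul1mx -!mulmxA [U *m _]mulmxA UU.
  by rewrite [W *m _]mulmxA WU !mulmx0 subr0 !mulmxN mulmx1 subrr.
have PW : P *m A *m W^T = 0.
  rewrite /P !mulmxDl !mulNmx mul1mx -!mulmxA [U *m _]mulmxA UW.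
  by rewrite [W *m _]mulmxA WW !mulmx0 addr0 mulmx1 subrr.
have PP : P *m A *m P^T = P *m A.
  have -> : P^T = 1%:M - U^T *m (A *m W^T)^T + W^T *m (A *m U^T)^T.
    by rewrite /P linearD linearB /= trmx1 -!trmx_mul.
  by rewrite mulmxDr mulmxBr mulmx1 !mulmxA PU PW !mul0mx subr0 addr0.
have [i [j Aij]] : exists i j, (P *m A *m P^T) i j != 0.
  case: (pickP (fun ij => (P *m A *m P^T) ij.1 ij.2 != 0)) => [[i j] nz|H].
    by exists i, j.
  have PA0 : P *m A = 0.
    rewrite -PP; apply/matrixP => i j; rewrite [RHS]mxE.
    by move: (H (i, j)) => /= /negbFE /eqP.
  move: le_r; rewrite addSn addnS /= leqNgt ltnS => /negP[].
  (* If $PA=0$, then $A$ factors through dimension $2r$, against the bound $2r+1$ on its rank. *)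
  have -> : A = row_mx (A *m W^T) (- A *m U^T) *m col_mx (U *m A) (W *m A).
    rewrite mul_row_col !mulNmx; apply/eqP; rewrite -subr_eq0 -{}PA0 /P !mulmxDl
      mul1mx mulNmx.
    by rewrite !mulmxA opprD opprK addrA.
  exact: mulmx_max_rank.
pose u := ((P *m A *m P^T) i j)^-1 *: row i P.
pose w := row j P.
have uU : u *m A *m U^T = 0 by rewrite -!scalemxAl -!row_mul PU linear0 scaler0.
have uW : u *m A *m W^T = 0 by rewrite -!scalemxAl -!row_mul PW linear0 scaler0.
have wU : w *m A *m U^T = 0 by rewrite -!row_mul PU linear0.
have wW : w *m A *m W^T = 0 by rewrite -!row_mul PW linear0.
have Uu : U *m A *m u^T = 0 by rewrite skT uU trmx0 oppr0.
have Wu : W *m A *m u^T = 0 by rewrite skT uW trmx0 oppr0.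
have Uw : U *m A *m w^T = 0 by rewrite skT wU trmx0 oppr0.
have Ww : W *m A *m w^T = 0 by rewrite skT wW trmx0 oppr0.
have dg (v : 'rV_m) : v *m A *m v^T = 0.
  by apply/matrixP => a b; rewrite !ord1 skew_diag0 // mxE.
have uw : u *m A *m w^T = 1%:M.
  apply/matrixP => a b; rewrite !ord1 -!scalemxAl -!row_mul tr_row [LHS]mxE [RHS]mxE
    eqxx.
  have -> : row i (P *m A *m col j P^T) 0 0 = (P *m A *m P^T) i j.
    by rewrite !mxE; apply: eq_bigr => k _; rewrite !mxE.
  by rewrite mulVf.
have split1 : 1%:M = block_mx 1%:M 0 0 1%:M :> 'M[F]_(1 + r) by exact: scalar_mx_block.
exists (col_mx u U), (col_mx w W); rewrite -[r.+1]/(1 + r)%N split1.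
rewrite !tr_col_mx !(mul_col_mx _ _ A) !mul_col_row
  !(UU, UW, WW, dg, Uu, uU, wW, Ww, uW, Uw, uw).
by rewrite !block_mx0.
Qed.

Lemma skew_congr_symplectic r (A : 'M[F]_(r + r)) :
  A^T = - A -> ((r + r).-1 <= \rank A)%N ->
  exists G : 'M[F]_(r + r), G *m A *m G^T = symplectic F r.
Proof.
move=> skA /(skew_pairs skA) [U [W [UU WW UW]]]; exists (col_mx U W).
rewrite tr_col_mx mul_col_mx mul_col_row UU WW UW; congr block_mx.
by rewrite skew_mulmx_tr // UW trmx1.
Qed.

Lemma symplectic_unit r : symplectic F r \in unitmx.
Proof.
suff /mulmx1_unit[]: symplectic F r *m - symplectic F r = 1%:M by [].
rewrite mulmxN /symplectic mulmx_block !mul0mx !mulmx0 !mul1mx !mulmx1.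
by rewrite !addr0 !add0r opp_block_mx !oppr0 opprK -scalar_mx_block.
Qed.

(** A skew matrix of even size cannot have corank exactly 1. *)
Lemma skew_unitmx r (A : 'M[F]_(r + r)) :
  A^T = - A -> ((r + r).-1 <= \rank A)%N -> A \in unitmx.
Proof.
move=> skA /(skew_congr_symplectic skA) [G GA].
by have := symplectic_unit r; rewrite -GA !unitmx_mul => /andP[/andP[]].
Qed.

Lemma pf_skew_neq0 r (A : 'M[F]_(r + r)) : A^T = - A -> A \in unitmx -> pf A != 0.
Proof.
move=> skA uA; have [|G GA] := skew_congr_symplectic skA.
  by rewrite (mxrank_unit uA) leq_pred.
have := pf_symplectic_neq0 F r; rewrite -GA pfM; apply: contraNneq => ->.
by rewrite mulr0.
Qed.

End SkewNormalForm.

(** Sylvester's determinant identity, from two block triangular factorizations of one matrix. *)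
Lemma det_one_add_mulC (R : comNzRingType) m k (a : 'M[R]_(m, k)) (b : 'M[R]_(k, m)) :
  \det (1%:M + a *m b) = \det (1%:M + b *m a).
Proof.
have e1 : block_mx 1%:M a (- b) 1%:M
    = block_mx 1%:M a 0 1%:M *m block_mx (1%:M + a *m b) 0 (- b) 1%:M.
  rewrite mulmx_block ?(mul1mx, mul0mx, mulmx1, mulmx0) mulmxN.
  by rewrite !add0r addrK.
have e2 : block_mx 1%:M a (- b) 1%:M
    = block_mx 1%:M 0 (- b) 1%:M *m block_mx 1%:M a 0 (1%:M + b *m a).
  rewrite mulmx_block ?(mul1mx, mul0mx, mulmx1, mulmx0) mulNmx.
  by rewrite !addr0 addrC addrK.
have := congr1 determinant e1; rewrite e2 !det_mulmx !det_lblock !det_ublock !det1.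
by rewrite !mulr1 !mul1r => ->.
Qed.

(** Gives a basis whose number of rows is syntactically [k], such as $r+r$, as block matrices and
    [pf] require. *)
Lemma exists_row_base (F : fieldType) m n (A : 'M[F]_(m, n)) k :
  \rank A = k -> exists2 K : 'M_(k, n), row_free K & (K :=: A)%MS.
Proof. by move=> <-; exists (row_base A); [apply: row_base_free | apply: eq_row_base].
  Qed.

(** * The Pfaffian at singular skew matrices *)

Section SingularPfaffian.
Variables (F : numFieldType) (r : nat) (A : 'M[F]_(r + r)).
Hypothesis skA : A^T = - A.

(** For $kA=0$ and $ke=1$, the matrix $g=1-ek$ has determinant 0 and satisfies $gAg^T=A$; apply
    [pfM]. *)
Lemma pf_singular : A \notin unitmx -> pf A = 0.
Proof.
rewrite -row_free_unit -kermx_eq0 => /rowV0Pn [k kA k0].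
have {kA} kA : k *m A = 0 by apply/sub_kermxP.
have /row_freeP[e ke] : row_free k by rewrite /row_free rank_rV k0.
have gA : (1%:M - e *m k) *m A = A by rewrite mulmxBl mul1mx -mulmxA kA mulmx0 subr0.
have := pfM (1%:M - e *m k) A.
rewrite gA -[A *m _]trmxK trmx_mul trmxK skA mulmxN gA linearN /= skA opprK => ->.
by rewrite -mulmxN det_one_add_mulC mulNmx ke subrr det0 mul0r.
Qed.

(** At corank 2 the Pfaffian vanishes only to first order. The direction $D$ restricts to a
    symplectic form on the kernel of $A$, which makes $A+D$ invertible. *)
Lemma pf_corank2 : (\rank A).+2 = (r + r)%N ->
  exists2 D : 'M[F]_(r + r), D^T = - D & exists2 c : F, c != 0 &
    pf (map_mx polyC A + 'X *: map_mx polyC D) = 'X * c%:P.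
Proof.
move=> rkA; have [|K /row_freeP[E KE] eqK] := @exists_row_base _ _ _ (kermx A) (1 + 1).
  by rewrite mxrank_ker; apply: (canLR (addnK _)); rewrite addnC addn2 rkA.
have KA : K *m A = 0 by apply/sub_kermxP; rewrite eqK.
have AK : A *m K^T = 0.
  by rewrite -[LHS]trmxK trmx_mul trmxK skA mulmxN KA oppr0 trmx0.
pose J := symplectic F 1.
have skJ : J^T = - J.
  rewrite /J /symplectic tr_block_mx !linearN /= !trmx0 trmx1.
  by rewrite opp_block_mx !oppr0 opprK.
pose D := E *m J *m E^T.
have skD : D^T = - D by rewrite /D !trmx_mul trmxK skJ mulNmx mulmxN mulmxA.
exists D => //; exists (pf (A + D)).
  apply: pf_skew_neq0; first by rewrite linearD /= skA skD opprD.
  rewrite -row_free_unit -kermx_eq0.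
  move: (kermx _) (mulmx_ker (A + D)) => M; rewrite mulmxDr => MAD.
  have ME : M *m E = 0.
    have := congr1 (fun X => X *m K^T) MAD.
    rewrite mulmxDl -mulmxA AK mulmx0 add0r mul0mx /D -!mulmxA -trmx_mul KE trmx1
      mulmx1.
    by rewrite mulmxA => ME0; rewrite -[LHS](mulmxK (symplectic_unit F 1)) ME0 mul0mx.
  have : (M <= K)%MS.
    rewrite eqK; apply/sub_kermxP.
    by have := MAD; rewrite /D !mulmxA ME !mul0mx addr0.
  by move=> /submxP[X MX]; move: ME; rewrite MX -mulmxA KE mulmx1 => ->; rewrite mul0mx.
(* [g] fixes [A] and multiplies [D] by ['X], so pf (A + 'X D) = \det g * pf (A + D). *)
pose C k l := @map_mx F {poly F} polyC k l.
(* On the kernel plane, the diagonal matrix with entries $X$ and $1$ scales the symplectic form by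
   $X$. *)
pose T : 'M[{poly F}]_(1 + 1) := block_mx 'X%:M 0 0 1%:M.
pose g := 1%:M + C _ _ E *m ((T - 1%:M) *m C _ _ K).
have detg : \det g = 'X.
  rewrite /g det_one_add_mulC -mulmxA -map_mxM KE map_mx1 mulmx1 [1%:M + _]addrC subrK.
  by rewrite det_ublock det_scalar1 det1 mulr1.
have gA : g *m C _ _ A = C _ _ A.
  by rewrite /g mulmxDl mul1mx -!mulmxA -map_mxM KA map_mx0 !mulmx0 addr0.
have gE : g *m C _ _ E = C _ _ E *m T.
  rewrite /g mulmxDl mul1mx -!mulmxA -map_mxM KE map_mx1 mulmx1.
  by rewrite mulmxBr mulmx1 [_ + (_ - _)]addrC subrK.
have gAg : g *m C _ _ A *m g^T = C _ _ A.
  have skCA : (C _ _ A)^T = - C _ _ A by rewrite map_trmx skA map_mxN.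
  by rewrite gA -[LHS]trmxK trmx_mul trmxK skCA mulmxN gA linearN /= skCA opprK.
have TJT : T *m C _ _ J *m T^T = 'X *: C _ _ J.
  rewrite /T /C /J /symplectic map_block_mx tr_block_mx !map_mx0 map_mxN !map_mx1
    !trmx0 trmx1 tr_scalar_mx.
  rewrite !mulmx_block !mul0mx !mulmx0 !mul1mx !mulmx1 !addr0 !add0r.
  by rewrite scale_block_mx !scaler0 scalerN scalemx1 mulNmx mul1mx mul0mx.
have gDg : g *m C _ _ D *m g^T = 'X *: C _ _ D.
  rewrite /D /C !map_mxM -map_trmx !mulmxA gE -!mulmxA -trmx_mul gE trmx_mul.
  by rewrite !mulmxA -[_ *m T *m _]mulmxA -[_ *m (_ *m _) *m _]mulmxA TJT -scalemxAr
    -scalemxAl.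
rewrite -[map_mx polyC A]gAg -['X *: map_mx polyC D]gDg -mulmxDl -mulmxDr.
by rewrite pfM detg -map_mxD map_pf.
Qed.

End SingularPfaffian.

(** * Projection onto so(W) *)

Lemma mxtrace_mul_delta (R : comNzRingType) m n (z : 'M[R]_(m, n)) i j :
  \tr (z *m delta_mx j i) = z i j.
Proof.
rewrite /mxtrace (bigD1 i) //= big1 ?addr0 => [|k nek].
  rewrite !mxE (bigD1 j) //= big1 ?addr0 ?mxE ?eqxx ?mulr1 // => l nel.
  by rewrite !mxE (negbTE nel) mulr0.
by rewrite !mxE big1 // => l _; rewrite !mxE (negbTE nek) andbF mulr0.
Qed.

(** Gram matrix formula for the $B$-orthogonal projection of row vectors onto [W]. *)
HB.lock Definition oproj (F : fieldType) n (B W : 'M[F]_n) : 'M[F]_n :=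
  let b := row_base W in B *m b^T *m invmx (b *m B *m b^T) *m b.

Section OrthogonalProjection.
Variables (F : numFieldType) (n : nat) (B : 'M[F]_n).
Hypotheses (B_sym : B^T = B) (B_unit : B \in unitmx).

Lemma map_mx_idfun k l (A : 'M[F]_(k, l)) : map_mx idfun A = A.
Proof. by apply/matrixP => i j; rewrite mxE. Qed.

Lemma so_tr x : x \in so B -> x *m B = - (B *m x^T).
Proof. by rewrite mem_so addr_eq0 => /eqP. Qed.

Lemma so_trmx x : x \in so B -> x^T = - (invmx B *m x *m B).
Proof.
by move=> /so_tr xB; rewrite -mulmxA xB mulmxN opprK mulKmx.
Qed.

Lemma so_skew x : (x \in so B) = ((x *m B)^T == - (x *m B)).
Proof. by rewrite mem_so trmx_mul B_sym addrC addr_eq0. Qed.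

(** The trace form is nondegenerate on so(B): pairing $z$ with the skew part $a-Ba^TB^{-1}$ of an
    elementary matrix $a$ gives twice an entry of $z$. *)
Lemma tr_so_eq0 z : z \in so B -> (forall v, v \in so B -> \tr (z *m v) = 0) -> z = 0.
Proof.
move=> zso H; apply/matrixP => i j.
pose a : 'M[F]_n := delta_mx j i.
have aso : a - B *m a^T *m invmx B \in so B.
  rewrite so_skew mulmxBl mulmxKV // linearB /= !trmx_mul trmxK B_sym.
  by rewrite opprB.
have := H _ aso; rewrite mulmxBr linearB /= !mulmxA so_tr // !mulNmx linearN opprK.
rewrite -(mulmxA B) [X in _ + X]mxtrace_mulC mulKmx // -trmx_mul mxtrace_tr.
rewrite [X in _ + X]mxtrace_mulC -mulr2n => /eqP; rewrite mulrn_eq0 /=.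
by rewrite mxtrace_mul_delta => /eqP ->; rewrite mxE.
Qed.

Section Nondegenerate.
Variable W : 'M[F]_n.
Hypothesis W_nondeg : nondegenerate_subspace B W.
Local Notation P := (oproj B W).
Local Notation b := (row_base W).

Lemma gram_unit : b *m B *m b^T \in unitmx.
Proof.
rewrite -row_free_unit -kermx_eq0; move: (kermx _) (mulmx_ker (b *m B *m b^T)) => K K0.
have : (K *m b <= W :&: orthomx idfun B W)%MS.
  rewrite sub_capmx (submx_trans (submxMl _ _)) ?eq_row_base //=.
  apply/sub_kermxP; rewrite map_mx_idfun.
  have /submxP[t /(congr1 trmx)] : (W <= b)%MS by rewrite eq_row_base.
  by rewrite [RHS]trmx_mul => ->; rewrite !mulmxA in K0 *; rewrite K0 mul0mx.
rewrite W_nondeg submx0 => /eqP Kb.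
by rewrite -(mulmx_free_eq0 _ (row_base_free W)) Kb.
Qed.

Lemma oproj_base : b *m P = b.
Proof. by rewrite oproj.unlock !mulmxA mulmxV ?gram_unit // mul1mx. Qed.

Lemma eq_oproj : (P :=: W)%MS.
Proof.
apply: (eqmx_trans _ (eq_row_base W)); apply/eqmxP.
by rewrite {1}oproj.unlock submxMl /= -{1}[row_base W]oproj_base submxMl.
Qed.

Lemma oproj_id k (u : 'M_(k, n)) : (u <= W)%MS -> u *m P = u.
Proof. by rewrite -(eq_row_base W) => /submxP[t ->]; rewrite -mulmxA oproj_base. Qed.

Lemma oproj_subP k (u : 'M_(k, n)) : reflect (u *m P = u) (u <= W)%MS.
Proof.
apply: (iffP idP) => [|<-]; first exact: oproj_id.
by rewrite -eq_oproj submxMl.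
Qed.

Lemma oproj_idem : P *m P = P.
Proof. by apply: oproj_id; rewrite eq_oproj. Qed.

Lemma oproj_form : P *m B = B *m P^T.
Proof.
rewrite oproj.unlock; move: (row_base W) => c.
rewrite !trmx_mul trmxK B_sym !mulmxA trmx_inv !trmx_mul trmxK.
by rewrite B_sym !mulmxA.
Qed.

(** The orthogonal complement of [W] is the row space of $1-P$, so annihilating it means $Pz=z$. *)
Lemma orthomx_mulmx_eq0 k (z : 'M_(n, k)) :
  (orthomx idfun B W *m z == 0) = (P *m z == z).
Proof.
pose O := orthomx idfun B W.
have OP : O *m P = 0.
  rewrite oproj.unlock !mulmxA.
  have /submxP[t /(congr1 trmx)] : (row_base W <= W)%MS by rewrite eq_row_base.
  rewrite [RHS]trmx_mul => ->; have : O *m (B *m W^T) = 0 by rewrite /O /orthomx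
    map_mx_idfun mulmx_ker.
  by rewrite !mulmxA => ->; rewrite !mul0mx.
have PO : ((1%:M - P) <= O)%MS.
  apply/sub_kermxP; rewrite map_mx_idfun.
  have /submxP[t /(congr1 trmx)] : (W <= b)%MS by rewrite eq_row_base.
  rewrite [RHS]trmx_mul => ->; rewrite !mulmxA mulmxBl mul1mx oproj_form mulmxBl
    -mulmxA -trmx_mul oproj_base subrr.
  by rewrite mul0mx.
apply/eqP/eqP => [Oz|<-]; last by rewrite mulmxA OP mul0mx.
have /submxP[t tO] := PO.
by apply/eqP; rewrite eq_sym -subr_eq0 -{1}[z]mul1mx -mulmxBl tO -mulmxA Oz mulmx0.
Qed.

Lemma mem_so_subE z : (z \in so_sub B W) = (z \in so B) && (P *m z == z).
Proof. by rewrite mem_so_sub orthomx_mulmx_eq0. Qed.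

(** By skewness, an element that kills the complement of [W] also has its image in [W]. *)
Lemma so_sub_mulr z : z \in so_sub B W -> z *m P = z.
Proof.
rewrite mem_so_subE so_skew => /andP[/eqP skz /eqP Pz].
apply: (can_inj (mulmxK B_unit)).
rewrite -mulmxA oproj_form mulmxA -[z *m B]opprK -skz mulNmx -trmx_mul.
by rewrite mulmxA Pz skz opprK.
Qed.

Lemma oproj_so x : x \in so B -> P *m x *m P \in so_sub B W.
Proof.
move=> xso; rewrite mem_so_subE !mulmxA oproj_idem eqxx andbT so_skew.
move: xso; rewrite so_skew => /eqP skx.
have -> : P *m x *m P *m B = P *m (x *m B) *m P^T by rewrite -!mulmxA oproj_form.
by rewrite !trmx_mul trmxK -trmx_mul skx mulNmx mulmxN !mulmxA.
Qed.

(** Since $z=PzP$ on so(W), cyclicity of the trace makes $x-PxP$ orthogonal to so(W). The sum is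
    direct because the trace form is nondegenerate. *)
Lemma so_projE x : x \in so B -> so_proj B W x = P *m x *m P.
Proof.
move=> xso; set U := so_sub B W; set V := trace_orth B U.
have UV : (U :&: V = 0)%VS.
  apply/eqP; rewrite -subv0; apply/subvP => z; rewrite memv_cap => /andP[zU zV].
  have [zso zP] := mem_trace_orth _ _ _ zV.
  rewrite memv0; apply/eqP/tr_so_eq0 => // v vso.
  have Pz : P *m z = z by move: zU; rewrite mem_so_subE => /andP[_ /eqP].
  rewrite -{1}Pz -{1}(so_sub_mulr zU) -!mulmxA mxtrace_mulC -!mulmxA.
  by rewrite zP // !mulmxA oproj_so.
pose w := x - P *m x *m P.
have PxP := oproj_so xso.
have wV : w \in V.
  apply/mem_trace_orth; split=> [|z zU].
    by rewrite rpredB //; move: PxP; rewrite mem_so_sub => /andP[].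
  have Pz : P *m z = z by move: zU; rewrite mem_so_subE => /andP[_ /eqP].
  rewrite mulmxBl linearB /= -[P *m x *m P *m z]mulmxA Pz -mulmxA.
  by rewrite [\tr (P *m _)]mxtrace_mulC -mulmxA (so_sub_mulr zU) subrr.
have w0 : daddv_pi U V w = 0.
  have := daddv_pi_add UV (subvP (addvSr U V) _ wV).
  by rewrite (@daddv_pi_id _ _ V U) 1?capvC // -[X in _ = X]add0r => /addIr.
rewrite -[x in LHS](subrK (P *m x *m P)) linearD /= -/w /so_proj -/U -/V w0 add0r.
exact: daddv_pi_id.
Qed.

End Nondegenerate.
End OrthogonalProjection.

(** * Directional derivatives *)

Lemma poly_eq_horner (F : numFieldType) (p q : {poly F}) :
  (forall t, p.[t] = q.[t]) -> p = q.
Proof.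
move=> H; apply/eqP; rewrite -subr_eq0; apply/negPn/negP => nz.
suff : (size [seq i%:R : F | i <- iota 0 (size (p - q)%R)] < size (p - q)%R)%N.
  by rewrite size_map size_iota ltnn.
apply: max_poly_roots => //; last first.
  by rewrite map_inj_uniq ?iota_uniq //; apply: mulrIn; apply: oner_neq0.
by apply/allP => _ /mapP[i _ ->]; rewrite rootE hornerD hornerN H subrr.
Qed.

Section Directional.
Variables (F : numFieldType) (n : nat).
Implicit Types (p : {mpoly F[n * n]}) (x v : 'M[F]_n).

(** Chain rule: both sides are additive and obey the Leibniz rule, so constants and variables
    suffice. *)
Lemma deriv_mmap m (h : 'I_m -> {poly F}) (p : {mpoly F[m]}) :
  (mmap polyC h p)^`() = \sum_k mmap polyC h p^`M(k) * (h k)^`().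
Proof.
pose P (p : {mpoly F[m]}) :=
  (mmap polyC h p)^`() = \sum_k mmap polyC h p^`M(k) * (h k)^`().
have PC c : P c%:MP.
  by rewrite /P mmapC derivC big1 // => k _; rewrite mderivC mmap0 mul0r.
have PD (p1 q : {mpoly F[m]}) : P p1 -> P q -> P (p1 + q).
  rewrite /P mmapD derivD => -> ->; rewrite -big_split /=.
  by apply: eq_bigr => k _; rewrite mderivD mmapD mulrDl.
have PM (p1 q : {mpoly F[m]}) : P p1 -> P q -> P (p1 * q).
  rewrite /P rmorphM derivM => -> ->; rewrite mulr_suml mulr_sumr -big_split /=.
  apply: eq_bigr => k _; rewrite mderivM mmapD !rmorphM mulrDl.
  by rewrite mulrAC -!mulrA.
have PX i : P 'X_i.
  rewrite /P mmapX mmap1U (bigD1 i) //= big1 ?addr0 => [|k nek].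
    by rewrite mderivX mnm1E eqxx scale1r -[X in (X - _)%MM]addm0
      [(U_(i) + 0)%MM]addmC addmK mpolyX0 -mpolyC1 mmapC mul1r.
  by rewrite mderivX mnm1E eq_sym (negbTE nek) scale0r mmap0 mul0r.
rewrite -/(P p); apply: (@mpolyind _ _ P) p => [|c k p _ _ IHp];
  first by rewrite -mpolyC0; exact: PC.
apply: (PD) => //; rewrite -mul_mpolyC; apply: (PM) => //; rewrite mpolyXE_id.
apply: (big_ind P) => [||i _]; [by rewrite -mpolyC1; exact: PC | exact: PM | ].
elim: (k i) => [|l IHl]; first by rewrite expr0 -mpolyC1; exact: PC.
by rewrite exprS; apply: (PM).
Qed.

Lemma horner_mmap m (h : 'I_m -> {poly F}) (p : {mpoly F[m]}) t :
  (mmap polyC h p).[t] = p.@[fun k => (h k).[t]].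
Proof.
rewrite /mmap mevalE horner_sum; apply: eq_bigr => k _.
rewrite hornerM hornerC; congr (_ * _); rewrite /mmap1 horner_prod.
by apply: eq_bigr => i _; rewrite horner_exp.
Qed.

Definition line_coord x v (k : 'I_(n * n)) : {poly F} :=
  (mxvec x 0 k)%:P + 'X * (mxvec v 0 k)%:P.

(** Restriction of $p$ to the line $x+tv$ as a polynomial in $t$. Such a polynomial is determined by
    its values, so directional derivatives become formal ones. *)
Definition mpoly_along p x v : {poly F} := mmap polyC (line_coord x v) p.

Lemma horner_mpoly_along p x v t : (mpoly_along p x v).[t] = peval p (x + t *: v).
Proof.
rewrite horner_mmap; apply: meval_eq => k.
by rewrite /line_coord !hornerE linearD linearZ !mxE.
Qed.

Definition dirderiv p x v : F := (mpoly_along p x v)^`().[0].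

Lemma dirderivE p x v : dirderiv p x v = \sum_k (p^`M(k)).@[mxvec x 0] * mxvec v 0 k.
Proof.
rewrite /dirderiv deriv_mmap horner_sum; apply: eq_bigr => k _.
rewrite hornerM horner_mmap; congr (_ * _).
  by apply: meval_eq => i; rewrite /line_coord !hornerE.
by rewrite /line_coord derivD derivM derivX !derivC !hornerE.
Qed.

Lemma differentialE (U : {vspace 'M[F]_n}) p x (v : subvs_of U) :
  differential U p x v = dirderiv p x (vsval v).
Proof. by rewrite lfunE /= dirderivE. Qed.

Lemma mpoly_along_eq p q x v y w : (forall t, peval p (x + t *: v) = peval q
  (y + t *: w)) ->
  mpoly_along p x v = mpoly_along q y w.
Proof. by move=> H; apply: poly_eq_horner => t; rewrite !horner_mpoly_along. Qed.

Lemma dirderiv_pullback L p x v : dirderiv (pullback L p) x v = dirderiv p (L x) (L v).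
Proof.
rewrite /dirderiv; congr (_^`().[0]); apply: mpoly_along_eq => t.
by rewrite pullbackE linearD linearZ.
Qed.

Lemma dirderiv_trace p x : exists N : 'M[F]_n, forall v, dirderiv p x v = \tr (N *m v).
Proof.
exists (vec_mx (\row_k (p^`M(k)).@[mxvec x 0]))^T => v; rewrite dirderivE.
set d := (X in vec_mx X).
transitivity ((d *m (mxvec v)^T) 0 0).
  by rewrite !mxE; apply: eq_bigr => k _; rewrite !mxE.
rewrite -{1}[d]vec_mxK; move: (vec_mx d) => N; rewrite mxE.
rewrite (reindex _ (curry_mxvec_bij n n)) /= /mxtrace.
transitivity (\sum_p N p.1 p.2 * v p.1 p.2).
  by apply: eq_bigr => [[i j]] _ /=; rewrite !mxE !mxvecE.
rewrite -(pair_bigA _ (fun i j => N i j * v i j)) exchange_big /=.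
by apply: eq_bigr => j _; rewrite mxE; apply: eq_bigr => i _; rewrite mxE.
Qed.

(** The quadratic term does not change the derivative at 0; this admits the curves
    $(1+ta)\,y\,(1+ta)^*$ obtained by congruence. *)
Lemma dirderiv_curve p x v w (q : {poly F}) :
  (forall t, peval p (x + t *: v + t ^+ 2 *: w) = q.[t]) -> dirderiv p x v = q^`().[0].
Proof.
pose h k := line_coord x v k + 'X^2 * (mxvec w 0 k)%:P.
move=> H; have <- : mmap polyC h p = q.
  apply: poly_eq_horner => t; rewrite horner_mmap -H; apply: meval_eq => k.
  by rewrite /h /line_coord !hornerE !(linearD, linearZ) !mxE.
rewrite dirderivE deriv_mmap horner_sum; apply: eq_bigr => k _.
rewrite hornerM horner_mmap; congr (_ * _).
  by apply: meval_eq => i; rewrite /h /line_coord !hornerE expr0n mul0r addr0.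
by rewrite /h /line_coord !derivD !derivM !derivX !derivC !hornerE /= !addr0.
Qed.

Lemma dirderiv_along p x v (q : {poly F}) :
  (forall t, peval p (x + t *: v) = q.[t]) -> dirderiv p x v = q^`().[0].
Proof. by move=> H; apply: (@dirderiv_curve p x v 0) => t; rewrite scaler0 addr0. Qed.

Definition gen_mx : 'M[{mpoly F[n * n]}]_n := \matrix_(i, j) 'X_(mxvec_index i j).

Lemma meval_gen_mx x : map_mx (meval (mxvec x 0)) gen_mx = x.
Proof. by apply/matrixP => i j; rewrite !mxE mevalXU mxvecE. Qed.

Definition tracepow k : {mpoly F[n * n]} := \tr (gen_mx ^+ k).

Lemma map_mxX (R S : pzRingType) (f : {rmorphism R -> S}) (A : 'M[R]_n) k :
  map_mx f (A ^+ k) = map_mx f A ^+ k.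
Proof.
elim: k => [|k IHk]; first by rewrite !expr0 map_mx1.
by rewrite !exprS -IHk [LHS]map_mxM.
Qed.

Lemma peval_tracepow k x : peval (tracepow k) x = \tr (x ^+ k).
Proof.
by rewrite /peval /tracepow -trace_map_mx map_mxX meval_gen_mx.
Qed.


Lemma deriv_mxX (Y : 'M[{poly F}]_n) k :
  map_mx deriv (Y ^+ k) = \sum_(i < k) Y ^+ i * map_mx deriv Y * Y ^+ (k.-1 - i).
Proof.
have dM (A A' : 'M[{poly F}]_n) :
    map_mx deriv (A * A') = map_mx deriv A * A' + A * map_mx deriv A'.
  apply/matrixP => i j; rewrite !mxE raddf_sum -big_split /=.
  by apply: eq_bigr => l _; rewrite derivM !mxE.
elim: k => [|k IHk].
  rewrite expr0 big_ord0; apply/matrixP => i j; rewrite !mxE.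
  by case: eqP => _ /=; rewrite ?deriv0 -?polyC1 ?derivC.
rewrite exprS dM IHk big_ord_recl expr0 mul1r subn0; congr (_ + _).
rewrite mulr_sumr; apply: eq_bigr => i _; rewrite !mulrA -exprS lift0.
by congr (_ * _ ^+ _); case: k i {IHk} => [[]|k i] //=; rewrite subSS.
Qed.

Lemma dirderiv_tracepow k x v : dirderiv (tracepow k.+1) x v = k.+1%:R * \tr
  (x ^+ k *m v).
Proof.
pose C := @map_mx F {poly F} polyC n n.
pose Y := C x + 'X *: C v.
have Yt t : map_mx (horner_eval t) Y = x + t *: v.
  by apply/matrixP => i j; rewrite !mxE /horner_eval !hornerE.
have dY : map_mx deriv Y = C v.
  apply/matrixP => i j; rewrite !mxE derivD derivM derivX !derivC.
  by rewrite add0r mulr0 addr0 mul1r.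
have -> : dirderiv (tracepow k.+1) x v = (\tr (Y ^+ k.+1))^`().[0].
  apply: dirderiv_along => t; rewrite peval_tracepow -Yt -map_mxX trace_map_mx.
  by [].
have -> : (\tr (Y ^+ k.+1))^`() = \tr (map_mx deriv (Y ^+ k.+1)).
  by rewrite /mxtrace raddf_sum; apply: eq_bigr => i _; rewrite [RHS]mxE.
rewrite deriv_mxX dY raddf_sum /=.
(* By cyclicity all $k+1$ terms of the Leibniz rule have the same trace. *)
rewrite (eq_bigr (fun=> \tr (Y ^+ k * C v))) => [|i _]; last first.
  rewrite mxtrace_mulC mulmxE mulrA -exprD subnK //.
  by rewrite -ltnS.
rewrite sumr_const card_ord hornerMn -mulr_natl; congr (_ * _).
rewrite -[_.[0]]/(horner_eval 0 _) -trace_map_mx [map_mx _ _]map_mxM map_mxX Yt.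
rewrite scale0r addr0; congr (\tr (_ *m _)).
by apply/matrixP => i j; rewrite !mxE; apply: hornerC.
Qed.
End Directional.

(** * Common stable subspaces *)

(** In a basis extending [s], the matrix [y] is block triangular with [T] as a diagonal block. *)
Lemma char_poly_restrict_dvd (F : fieldType) d m (s : 'M[F]_(d, m)) (y : 'M_m)
  (T : 'M_d) :
  row_free s -> s *m y = T *m s -> char_poly T %| char_poly y.
Proof.
move=> s_free sy.
have [|c c_free eqc] := @exists_row_base _ _ _ (s^C)%MS (m - d)%N.
  by rewrite mxrank_compl (eqP s_free).
have le_dm : (d <= m)%N by rewrite -(eqP s_free) rank_leq_col.
move: c c_free eqc; have := subnKC le_dm; move: (m - d)%N => e me;
  subst m => c c_free eqc.
pose E := col_mx s c.
have uE : E \in unitmx.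
  rewrite -row_full_unit /row_full -addsmxE (adds_eqmx (eqmx_refl s) eqc).
  exact: addsmx_compl_full.
pose Z := c *m y *m invmx E.
have EyL : E *m y = block_mx T 0 (lsubmx Z) (rsubmx Z) *m E.
  by rewrite mul_col_mx sy block_mxEv hsubmxK mul_col_mx mul_row_col mul0mx addr0
    mulmxKV.
have -> : char_poly y = char_poly (block_mx T 0 (lsubmx Z) (rsubmx Z)).
  pose EX := map_mx polyC E.
  have EXn0 : \det EX != 0 by rewrite det_map_mx polyC_eq0 -unitfE -unitmxE.
  apply: (mulfI EXn0); rewrite /char_poly [RHS]mulrC -!det_mulmx; congr determinant.
  rewrite /char_poly_mx mulmxBr mulmxBl -!map_mxM EyL; congr (_ - _).
  by rewrite scalar_mxC.
rewrite /char_poly /char_poly_mx map_block_mx map_mx0 scalar_mx_block opp_block_mx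
  add_block_mx.
by rewrite subr0 det_lblock dvdp_mulr.
Qed.

Section CommonSpectrum.
Variable F : closedFieldType.

(** Omitting one zero can affect $a$ only if $a=0$; then $b$ is a second zero and survives. *)
Lemma mem_spectrum2 m (A : 'M[F]_m) a b : (a != 0) || (b == 0) ->
  ('X - a%:P) * ('X - b%:P) %| char_poly A -> a \in spectrum A.
Proof.
rewrite /spectrum eigenvaluesP; set s := eigenvalues A => ab dv.
have as_ : a \in s.
  by rewrite -root_prod_XsubC -dvdp_XsubCl (dvdp_trans _ dv) // dvdp_mulr.
have bs : b \in rem a s.
  rewrite -root_prod_XsubC -dvdp_XsubCl.
  rewrite (big_rem a as_) /= dvdp_mul2l ?polyXsubC_eq0 // in dv.
case: (odd m) => //; have [a0|nz] := eqVneq a 0; last exact: rem_mem.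
by move: ab bs; rewrite a0 eqxx => /= /eqP->.
Qed.

(** Of two eigenvalues of [T], either one is nonzero or both are zero; [mem_spectrum2] covers both
    cases, whatever the parities of the sizes. *)
Lemma common_spectrum d m1 m2 (T : 'M[F]_d) (A1 : 'M[F]_m1) (A2 : 'M[F]_m2) :
  (1 < d)%N -> char_poly T %| char_poly A1 -> char_poly T %| char_poly A2 ->
  exists2 a, a \in spectrum A1 & a \in spectrum A2.
Proof.
move=> d_gt1 dv1 dv2.
have [a [b [ab dvT]]] : exists a b, ((a != 0) || (b == 0)) /\
    ('X - a%:P) * ('X - b%:P) %| char_poly T.
  have := size_char_poly T; rewrite eigenvaluesP.
  case: (eigenvalues T) => [|a [|b s]]; rewrite ?big_nil ?big_seq1 ?size_poly1
    ?size_XsubC => szT.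
  - by move: d_gt1; case: szT => <-.
  - by move: d_gt1; case: szT => <-.
  rewrite !big_cons mulrA.
  have [a0|nza] := eqVneq a 0; last by exists a, b; rewrite nza dvdp_mulr.
  have [b0|nzb] := eqVneq b 0; first by exists a, b; rewrite b0 eqxx orbT -b0 dvdp_mulr.
  by exists b, a; rewrite nzb [('X - b%:P) * _]mulrC dvdp_mulr.
by exists a; apply: (mem_spectrum2 ab); apply: dvdp_trans dvT _.
Qed.
End CommonSpectrum.

Section StableSubspace.
Variables (F : numClosedFieldType) (n : nat) (B W W' x : 'M[F]_n).
Hypotheses (B_sym : B^T = B) (B_unit : B \in unitmx).
Hypotheses (W_nondeg : nondegenerate_subspace B W)
  (W'_nondeg : nondegenerate_subspace B W').
Hypotheses (sWW' : (W <= W')%MS) (x_so : x \in so B).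
Local Notation P := (oproj B W).
Local Notation P' := (oproj B W').

Lemma oprojM : P *m P' = P.
Proof. by apply: oproj_id => //; rewrite eq_oproj. Qed.

Lemma oprojMr : P' *m P = P.
Proof.
apply: (can_inj (mulmxK B_unit)); rewrite -mulmxA !oproj_form // mulmxA oproj_form //.
by rewrite -mulmxA -trmx_mul oprojM.
Qed.

Lemma restrict_so_part Y k (u : 'M[F]_(k, n)) (T : 'M_k) : nondegenerate_subspace B Y ->
  row_free u -> (u <= Y)%MS -> u *m (oproj B Y *m x *m oproj B Y) = T *m u ->
  char_poly T %| char_poly (so_part B Y x).
Proof.
move=> Y_nondeg u_free uY uT.
have /submxP[s us] : (u <= row_base Y)%MS by rewrite eq_row_base.
have s_free : row_free s.
  by rewrite /row_free eqn_leq rank_leq_row -{1}(eqP u_free) us mxrankM_maxl.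
apply: (char_poly_restrict_dvd s_free).
rewrite /so_part so_projE //; set f := _ *m _ *m oproj B Y.
have bf : (row_base Y *m f <= row_base Y)%MS.
  by rewrite eq_row_base -(eq_oproj Y_nondeg) /f mulmxA submxMl.
have fb : restrictmx Y f *m row_base Y = row_base Y *m f by rewrite /conjmx mulmxKpV.
apply: (row_free_inj (row_base_free Y)).
by rewrite -[in LHS]mulmxA fb [in LHS]mulmxA -[in RHS]mulmxA -us uT.
Qed.

Lemma rank_common_stable k (U : 'M[F]_(k, n)) :
  (forall a, ~~ ((a \in spectrum (so_part B W x)) &&
    (a \in spectrum (so_part B W' x)))) ->
  (U <= W)%MS -> stablemx U (P' *m x *m P') -> (\rank U <= 1)%N.
Proof.
move=> disj UW stU; rewrite leqNgt; apply/negP => rkU.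
pose u := row_base U.
have uW : (u <= W)%MS by rewrite eq_row_base.
have /submxP[T uT] : (u *m (P' *m x *m P') <= u)%MS by rewrite stablemx_row_base.
(* The compressions of $x$ to [W] and [W'] agree on [u], as the second already sends it into [W]. *)
have uT' : u *m (P *m x *m P) = T *m u.
  have uP : u *m P = u by apply: oproj_id.
  have uP' : u *m P' = u by apply: oproj_id => //; apply: submx_trans sWW'.
  have -> : T *m u = T *m u *m P by rewrite -mulmxA uP.
  by rewrite -uT !mulmxA uP uP' -[RHS]mulmxA oprojMr.
have [a a1 a2] := common_spectrum rkU
  (restrict_so_part W_nondeg (row_base_free U) uW uT')
  (restrict_so_part W'_nondeg (row_base_free U) (submx_trans uW sWW') uT).
by have := disj a; rewrite a1 a2.
Qed.
End StableSubspace.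

(** Skew matrices have even rank: the hyperbolic pairs exhibit an invertible compression of size
    $2r$. *)
Lemma skew_rank_ge (F : numFieldType) m (A : 'M[F]_m) r :
  A^T = - A -> ((r + r).-1 <= \rank A)%N -> (r + r <= \rank A)%N.
Proof.
move=> skA /(skew_pairs skA) [U [W [UU WW UW]]].
have WU : W *m A *m U^T = - 1%:M by rewrite skew_mulmx_tr // UW trmx1.
have e : col_mx U W *m A *m (col_mx U W)^T = symplectic F r.
  by rewrite tr_col_mx mul_col_mx mul_col_row UU WW UW WU.
rewrite -(mxrank_unit (symplectic_unit F r)) -e.
by rewrite (leq_trans (mxrankM_maxl _ _)) // mxrankM_maxr.
Qed.

(** Each condition has rank at most one and so costs at most one dimension. *)
Lemma rank_capmx_ker (F : fieldType) n d (W : 'M[F]_n) (A : nat -> 'M[F]_n) :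
  (forall k, \rank (A k) <= 1)%N ->
  (\rank W <= d + \rank (W :&: \bigcap_(k < d) kermx (A k)))%N.
Proof.
move=> rkA; elim: d => [|d IHd]; first by rewrite big_ord0 capmx1.
apply: leq_trans IHd _; rewrite big_ord_recr /= capmxA.
set N := (W :&: _)%MS.
rewrite -(mxrank_mul_ker N (A d)) addSn -addnS leq_add2l addnC.
by rewrite -addn1 leq_add2l (leq_trans (mxrankM_maxr _ _)).
Qed.

(** * Two consecutive subspaces of the chain *)

Section CyclicPair.
Variables (F : numClosedFieldType) (n' : nat).
Local Notation n := n'.+1.
Variables (B W W' y : 'M[F]_n) (m : nat).
Hypotheses (B_sym : B^T = B) (B_unit : B \in unitmx).
Hypotheses (W_nondeg : nondegenerate_subspace B W)
  (W'_nondeg : nondegenerate_subspace B W').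
Hypotheses (sWW' : (W <= W')%MS) (rkW : (\rank W).+1 = m) (rkW' : \rank W' = m).
Hypothesis y_so : y \in so_sub B W'.
Hypothesis small_stable : forall k (U : 'M[F]_(k, n)),
  (U <= W)%MS -> stablemx U y -> (\rank U <= 1)%N.
Local Notation P := (oproj B W).
Local Notation P' := (oproj B W').

Lemma centralizer_eq0 z : z \in so_sub B W -> z *m y = y *m z -> z = 0.
Proof.
move=> zso zy.
have zW : (z <= W)%MS by apply/(oproj_subP W_nondeg)/so_sub_mulr.
have rkz : (\rank z <= 1)%N by apply: small_stable => //; rewrite zy submxMl.
have skz : (z *m B)^T = - (z *m B).
  by move: zso; rewrite mem_so_sub so_skew // => /andP[/eqP].
have rkzB : (\rank (z *m B) <= 1)%N by rewrite (leq_trans (mxrankM_maxl _ _)).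
suff : \rank (z *m B) == 0%N.
  by rewrite mxrank_eq0 => /eqP zB; rewrite -[z](mulmxK B_unit) zB mul0mx.
(* Evenness of the rank: with [r = 1], rank 1 would imply rank at least 2. *)
by rewrite -leqn0 -ltnS ltn_neqAle rkzB andbT; apply/eqP => e;
  have := @skew_rank_ge _ _ _ 1 skz; rewrite e => /(_ isT).
Qed.

(** Projection onto the line of [W'] orthogonal to [W]; a vector of [W'] lies in [W] exactly when
    [q] kills it. *)
Let q := P' - P.

Lemma rank_projB : (\rank q <= 1)%N.
Proof.
have -> : q = P' *m (1%:M - P) by rewrite mulmxBr mulmx1 oprojMr.
have := mxrank_mul_ker P' (1%:M - P).
have : (\rank P <= \rank (P' :&: kermx (1%:M - P)))%N.
  apply: mxrankS; rewrite sub_capmx !eq_oproj // sWW' /=.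
  by apply/sub_kermxP; rewrite mulmxBr mulmx1 oproj_id ?subrr.
rewrite !eq_oproj // rkW' -rkW => le_rk e; rewrite -(leq_add2r (\rank W)) add1n -e.
by rewrite leq_add2l.
Qed.

Lemma sub_of_mul_projB k (N : 'M[F]_(k, n)) : (N <= W')%MS -> N *m q = 0 -> (N <= W)%MS.
Proof.
move=> NW' Nq; apply/(oproj_subP W_nondeg); apply/eqP.
by rewrite -{2}(oproj_id W'_nondeg NW') eq_sym -subr_eq0 -mulmxBr Nq.
Qed.

Lemma so_sub_yr : y *m P' = y.
Proof. exact: so_sub_mulr. Qed.

(** The kernel of [y] in [W'] meets [W] in a stable subspace, of dimension at most 1, and [W] has
    codimension 1 in [W']. *)
Lemma corank_le2 : (m <= \rank y + 2)%N.
Proof.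
have yl : P' *m y = y by move: y_so; rewrite mem_so_subE // => /andP[_ /eqP].
pose K := (P' :&: kermx y)%MS.
have rkK : (\rank y + \rank K)%N = m by rewrite -{1}yl mxrank_mul_ker eq_oproj.
rewrite -rkK leq_add2l -(mxrank_mul_ker K q) -[2%N]/(1 + 1)%N leq_add //.
  by rewrite (leq_trans (mxrankM_maxr _ _)) // rank_projB.
set N := (K :&: kermx q)%MS.
have NK : (N <= K)%MS by apply: capmxSl.
have Ny : N *m y = 0 by apply/sub_kermxP; apply: submx_trans NK (capmxSr _ _).
apply: small_stable; last by rewrite Ny sub0mx.
apply: sub_of_mul_projB; last by apply/sub_kermxP; apply: capmxSr.
by rewrite -(eq_oproj W'_nondeg); apply: submx_trans NK (capmxSl _ _).
Qed.

Lemma pow_independent (p : {poly F}) : (size p < m)%N -> P' *m horner_mx y p = 0 -> p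
  = 0.
Proof.
(* Otherwise the vectors of W' killed by the [y ^+ k *m q] with [k < deg p], hence
   by all of them, form a stable subspace of W of dimension at least 2. *)
move=> szp Pp; apply/eqP/negPn/negP => p0.
pose d := (size p).-1.
have szd : size p = d.+1 by rewrite prednK // size_poly_gt0.
pose A k := y ^+ k *m q.
have rkA k : (\rank (A k) <= 1)%N by rewrite (leq_trans (mxrankM_maxr _ _)) //
  rank_projB.
have := @rank_capmx_ker _ _ d P' A rkA; set N := (P' :&: _)%MS.
have NP : N *m P' = N by apply: oproj_id => //; rewrite -(eq_oproj W'_nondeg) capmxSl.
have NA k : (k < d)%N -> N *m A k = 0.
  move=> kd; apply/sub_kermxP; apply: submx_trans (capmxSr _ _) _.
  exact: (bigcapmx_inf (Ordinal kd)).
(* As $p$ has nonzero leading coefficient, the relation $p(y)=0$ on $W'$ extends the vanishing to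
   exponent $d$; this makes [N] stable. *)
have NAd : N *m A d = 0.
  have : N *m horner_mx y p *m q = 0 by rewrite -NP -(mulmxA N) Pp mulmx0 mul0mx.
  rewrite -[p in horner_mx _ p]coefK poly_def szd rmorph_sum /= big_ord_recr /=.
  rewrite (mulmxDr N) mulmxDl mulmx_sumr mulmx_suml big1 ?add0r => [|k _];
    rewrite linearZ /= rmorphXn /= horner_mx_X -scalemxAr -scalemxAl -mulmxA.
    move/eqP; rewrite scaler_eq0 => /orP[/eqP|/eqP//].
    by rewrite -/(lead_coef p) => /eqP; rewrite lead_coef_eq0 (negbTE p0).
  by rewrite NA // scaler0.
have NW : (N <= W)%MS.
  apply: sub_of_mul_projB; first by rewrite -(eq_oproj W'_nondeg) capmxSl.
  (* When $d=0$ no condition was imposed on [N], and the vanishing comes from [NAd]. *)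
  have : N *m A 0%N = 0 by case: (posnP d) => [d0|];
    [rewrite -[X in A X]d0 | apply: NA].
  by rewrite /A expr0 mul1mx.
have Nst : stablemx N y.
  rewrite sub_capmx; apply/andP; split.
    by rewrite -so_sub_yr mulmxA submxMl.
  apply/sub_bigcapmxP => k _; apply/sub_kermxP.
  rewrite /A -mulmxA [y *m _]mulmxA -[y *m y ^+ k]exprS.
  have [->|nek] := eqVneq k.+1 d; first exact: NAd.
  by apply: NA; rewrite ltn_neqAle nek ltn_ord.
have := small_stable NW Nst => rkN.
rewrite eq_oproj // rkW' leqNgt => /negP[].
by rewrite (leq_ltn_trans (leq_add (leqnn d) rkN)) // addn1 -szd.
Qed.

End CyclicPair.

(** * Invariants and their gradients *)

Section Gradients.
Variables (F : numFieldType) (n : nat) (B W : 'M[F]_n).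
Hypotheses (B_sym : B^T = B) (B_unit : B \in unitmx).
Hypothesis W_nondeg : nondegenerate_subspace B W.
Implicit Types (Q : {mpoly F[n * n]}) (y v M g : 'M[F]_n).
Local Notation P := (oproj B W).

Lemma so_subW z : z \in so_sub B W -> [/\ z \in so B, P *m z = z & z *m P = z].
Proof.
move=> zU; split; last exact: so_sub_mulr.
  by move: zU; rewrite mem_so_sub => /andP[].
by move: zU; rewrite mem_so_subE // => /andP[_ /eqP].
Qed.

(** Gradient of the restriction of $Q$ to so(W), for the trace form. Testing on all $v$ in so(B)
    through $PvP$ makes it represent the differential of the pullback of $Q$. *)
Definition is_gradient Q y M : Prop :=
  M \in so_sub B W /\ forall v, v \in so B -> dirderiv Q y (P *m v *m P) = \tr (M *m v).

(** Represent the derivative by a trace, compress the representing matrix to [W] and take its skew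
    part for $B$. *)
Lemma gradient_exists Q y : exists M, is_gradient Q y M.
Proof.
have [N dirN] := dirderiv_trace Q y.
pose N1 := P *m N *m P.
have PN1 : P *m N1 = N1 by rewrite /N1 !mulmxA oproj_idem.
have N1P : N1 *m P = N1 by rewrite /N1 -!mulmxA oproj_idem.
have trN1 v : \tr (N *m (P *m v *m P)) = \tr (N1 *m v).
  by rewrite mulmxA mxtrace_mulC /N1 !mulmxA.
move: N1 PN1 N1P trN1 => N1 PN1 N1P trN1.
exists (2^-1 *: (N1 - B *m N1^T *m invmx B)); split=> [|v vso].
  rewrite mem_so_subE // so_skew // -scalemxAl -scalemxAr.
  apply/andP; split; apply/eqP.
    rewrite linearZ /= -scalerN; congr (_ *: _).
    by rewrite mulmxBl mulmxKV // linearB /= !trmx_mul trmxK B_sym opprB.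
  congr (_ *: _); rewrite mulmxBr PN1 !mulmxA oproj_form // -[B *m _ *m N1^T]mulmxA
    -trmx_mul.
  by rewrite N1P.
have half : \tr (B *m N1^T *m invmx B *m v) = - \tr (N1 *m v).
  rewrite -!mulmxA mxtrace_mulC -!mulmxA.
  have -> : invmx B *m (v *m B) = - v^T by rewrite (so_trmx B_unit vso) opprK mulmxA.
  by rewrite mulmxN linearN /= -trmx_mul mxtrace_tr mxtrace_mulC.
rewrite dirN trN1 -scalemxAl linearZ /= mulmxBl linearB /= half opprK.
by rewrite -mulr2n -[X in _ * X]mulr_natl mulrA mulVf ?mul1r // pnatr_eq0.
Qed.

Lemma SO_sub_unit g : SO_sub B W g -> g \in unitmx.
Proof. by case=> _ detg _; rewrite unitmxE detg unitr1. Qed.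

Lemma tracepow_invariant k : SO_invariant B W (tracepow F n k).
Proof.
move=> g y /SO_sub_unit gu _; rewrite !peval_tracepow.
have -> : (g *m y *m invmx g) ^+ k = g *m y ^+ k *m invmx g.
  elim: k => [|k IHk]; first by rewrite !expr0 mulmx1 mulmxV.
  rewrite !exprS IHk -!mulmxE.
  by rewrite !mulmxA mulmxKV.
by rewrite mxtrace_mulC mulmxA mulVmx // mul1mx.
Qed.

Lemma so_sub_pow y k : y \in so_sub B W -> odd k -> y ^+ k \in so_sub B W.
Proof.
move=> yU; have [yso Py yP] := so_subW yU.
have ykB : y ^+ k *m B = (-1) ^+ k *: (B *m (y ^+ k)^T).
  elim: k => [|k IHk]; first by rewrite !expr0 mul1mx trmx1 mulmx1 scale1r.
  rewrite {1}exprS -!mulmxE -mulmxA IHk -scalemxAr mulmxA (so_tr yso) mulNmx.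
  rewrite [y ^+ k.+1]exprSr -mulmxE trmx_mul mulmxA scalerN -scaleNr.
  by rewrite exprS mulN1r.
move=> kodd; rewrite mem_so_subE // mem_so ykB -signr_odd kodd expr1 scaleN1r addNr
  eqxx /=.
by case: k kodd {ykB} => // k _; rewrite exprS -!mulmxE mulmxA Py.
Qed.

Lemma tracepow_gradient k y : y \in so_sub B W -> odd k ->
  is_gradient (tracepow F n k.+1) y (k.+1%:R *: y ^+ k).
Proof.
move=> yU kodd; have [] := so_subW (so_sub_pow yU kodd).
move=> yk Pyk ykP; split=> [|v vso]; first by rewrite memvZ // so_sub_pow.
rewrite dirderiv_tracepow -scalemxAl linearZ /=; congr (_ * _).
by rewrite mulmxA mxtrace_mulC !mulmxA Pyk ykP.
Qed.

(** * The Pfaffian on so(W) *)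

Section PfaffianInvariant.
Variables (r : nat) (b : 'M[F]_(r + r, n)).
Hypotheses (b_free : row_free b) (eq_b : (b :=: W)%MS).

Lemma exists_section : exists2 e : 'M[F]_(n, r + r), b *m e = 1%:M & e *m b = P.
Proof.
have bP : b *m P = b by apply: oproj_id; rewrite ?eq_b.
have /row_freeP[e be] := b_free.
exists (P *m e); first by rewrite mulmxA bP.
have /submxP[s Ps] : (P <= b)%MS by rewrite eq_b eq_oproj.
by rewrite -mulmxA {1}Ps -mulmxA (mulmxA b) be mul1mx.
Qed.

(** Pfaffian of the skew form $(u,v)\mapsto u\,y\,B\,v^T$ written in the basis [b] of [W]. *)
Definition pfpoly : {mpoly F[n * n]} :=
  pf (map_mx (@mpolyC _ _) b *m gen_mx F n *m map_mx (@mpolyC _ _) (B *m b^T)).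

Lemma peval_pfpoly y : peval pfpoly y = pf (b *m y *m B *m b^T).
Proof.
rewrite /peval /pfpoly -map_pf !map_mxM meval_gen_mx -!map_mx_comp.
have mC k l (A : 'M[F]_(k, l)) : map_mx (meval (mxvec y 0) \o (@mpolyC (n * n) F)) A =
  A.
  by apply/matrixP => i j; rewrite mxE /= mevalC.
by rewrite !mC -!mulmxA.
Qed.

(** In the basis [b], $g$ acts by a matrix $h$ of determinant 1 and the form undergoes the
    congruence by $h$. *)
Lemma pfpoly_invariant : SO_invariant B W pfpoly.
Proof.
move=> g y gSO yU; have gu := SO_sub_unit gSO; case: gSO => gB detg gO.
have [e be eb] := exists_section; rewrite !peval_pfpoly.
have hP : P *m (g - 1%:M) = g - 1%:M.
  by apply/eqP; rewrite -orthomx_mulmx_eq0 // mulmxBr gO mulmx1 subrr.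
have Pg : (1%:M - P) *m g = 1%:M - P.
  rewrite -[g](subrK 1%:M) mulmxDr mulmx1 mulmxBl mul1mx hP.
  by rewrite subrr add0r.
(* Orthogonality converts fixing the complement of [W] into preserving [W]. *)
have gP : g *m (1%:M - P) = 1%:M - P.
  have PB : B *m (1%:M - P)^T = (1%:M - P) *m B.
    by rewrite linearB /= trmx1 mulmxBr mulmxBl mulmx1 mul1mx oproj_form.
  apply: (can_inj (mulmxK B_unit)).
  by rewrite -mulmxA -PB -{1}Pg trmx_mul !mulmxA gB.
have Pge : P *m g = P *m g *m P.
  apply/eqP; rewrite -subr_eq0 -{1}[P *m g]mulmx1 -mulmxBr -mulmxA gP.
  by rewrite mulmxBr mulmx1 oproj_idem // subrr.
pose h := b *m g *m e.
have bg : b *m g = h *m b.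
  rewrite /h -(mulmxA _ e) eb.
  have bP : b *m P = b by apply: oproj_id; rewrite ?eq_b.
  by rewrite -{1}bP -mulmxA Pge !mulmxA bP.
have deth : \det h = 1.
  (* $g$ differs from the identity only on [W], so [det_one_add_mulC] identifies its determinant
     with that of $h$. *)
  have gE : g = 1%:M + e *m ((h - 1%:M) *m b).
    rewrite mulmxBl mul1mx mulmxBr -bg mulmxA eb addrA addrAC.
    by apply/eqP; rewrite -subr_eq -Pg mulmxBl mul1mx.
  by rewrite -detg gE det_one_add_mulC -mulmxA be mulmx1 addrC subrK.
have giB : invmx g *m B = B *m g^T by rewrite -{1}gB -!mulmxA mulKmx.
rewrite -[b *m _ *m B]mulmxA -[g *m y *m _ *m B]mulmxA giB.
have -> : b *m (g *m y *m (B *m g^T)) *m b^T = h *m (b *m y *m B *m b^T) *m h^T.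
  by rewrite !mulmxA bg -!mulmxA -!trmx_mul bg.
by rewrite pfM deth mul1r.
Qed.

Lemma form_section y e : b *m e = 1%:M -> e *m b = P -> y \in so_sub B W ->
  y *m B = e *m (b *m y *m B *m b^T) *m e^T.
Proof.
move=> be eb /so_subW[_ Py yP].
rewrite !mulmxA eb Py -[RHS]mulmxA -trmx_mul eb.
by rewrite -mulmxA -oproj_form // mulmxA yP.
Qed.

Lemma form_skew y : y \in so B -> (b *m y *m B *m b^T)^T = - (b *m y *m B *m b^T).
Proof.
rewrite so_skew // => /eqP skew; rewrite -[b *m y *m B]mulmxA.
by rewrite !trmx_mul trmxK -trmx_mul skew mulNmx mulmxN !mulmxA.
Qed.

Lemma rank_le_form y : y \in so_sub B W -> (\rank y <= \rank (b *m y *m B *m b^T))%N.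
Proof.
move=> yU; have [e be eb] := exists_section.
rewrite -[y in X in (X <= _)%N](mulmxK B_unit) (form_section be eb yU).
apply: leq_trans (mxrankM_maxl _ _) _; apply: leq_trans (mxrankM_maxl _ _) _.
exact: mxrankM_maxr.
Qed.

Lemma form_unit y : y \in so_sub B W -> b *m y *m B *m b^T \in unitmx ->
  exists z, y *m z = P.
Proof.
move=> yU uA; have [e be eb] := exists_section.
exists (B *m b^T *m invmx (b *m y *m B *m b^T) *m b).
rewrite !mulmxA {1}(form_section be eb yU) -(mulmxA _ e^T) -trmx_mul be trmx1 mulmx1.
by rewrite mulmxK.
Qed.

(** Congruences preserve the vanishing of the Pfaffian, so [M] is orthogonal to the tangent
    directions of the congruence orbit of [y]; this says that $yM$ has zero trace against every
    matrix. *)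
Lemma pfpoly_gradient_mul0 y M : y \in so_sub B W ->
  b *m y *m B *m b^T \notin unitmx -> is_gradient pfpoly y M -> y *m M = 0.
Proof.
move=> yU nuA [MU dirM]; have [yso Py yP] := so_subW yU.
have [Mso PM MP] := so_subW MU.
have [e be eb] := exists_section.
have pfA : pf (b *m y *m B *m b^T) = 0 by rewrite pf_singular // form_skew.
have tr0 a : \tr (y *m M *m a) = 0.
  pose a1 := P *m a *m P.
  have Pa1 : P *m a1 = a1 by rewrite /a1 !mulmxA oproj_idem.
  have a1P : a1 *m P = a1 by rewrite /a1 -!mulmxA oproj_idem.
  have -> : \tr (y *m M *m a) = \tr (y *m M *m a1).
    rewrite /a1 !mulmxA [in RHS]mxtrace_mulC !mulmxA Py.
    by rewrite -[y *m M *m P]mulmxA MP.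
  move: a1 Pa1 a1P => a1 Pa1 a1P.
  pose v := a1 *m y + y *m B *m a1^T *m invmx B.
  (* [y + t v + t^2 w] is congruent to [y] by [1 + t a1], so its Pfaffian vanishes. *)
  pose w := a1 *m y *m B *m a1^T *m invmx B.
  have vso : v \in so B.
    rewrite so_skew // /v mulmxDl mulmxKV // linearD /= opprD addrC.
    move: yso; rewrite so_skew // -(mulmxA a1) => /eqP skew.
    by rewrite [(a1 *m _)^T]trmx_mul [(_ *m a1^T)^T]trmx_mul trmxK skew mulNmx mulmxN.
  have Pv : P *m v *m P = v.
    have iBP : invmx B *m P = P^T *m invmx B.
      by apply: (can_inj (mulKmx B_unit)); rewrite mulmxA mulmxV // mul1mx mulmxA
        -oproj_form // mulmxK.
    rewrite /v mulmxDr mulmxDl !mulmxA Pa1 Py -!mulmxA yP iBP.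
    by rewrite (mulmxA a1^T) -trmx_mul Pa1.
  have dv0 : dirderiv pfpoly y v = 0.
    rewrite (@dirderiv_curve _ _ _ _ _ w 0) ?deriv0 ?horner0 // => t;
      rewrite horner0 peval_pfpoly.
    pose h := b *m a1 *m e.
    have bh : b *m a1 = h *m b by rewrite /h -(mulmxA _ e) eb -mulmxA a1P.
    have -> : b *m (y + t *: v + t ^+ 2 *: w) *m B *m b^T
        = (1%:M + t *: h) *m (b *m y *m B *m b^T) *m (1%:M + t *: h)^T.
      have -> : (1%:M + t *: h) *m (b *m y *m B *m b^T) *m (1%:M + t *: h)^T
          = b *m ((1%:M + t *: a1) *m y *m B *m (1%:M + t *: a1)^T) *m b^T.
        have bt : b *m (1%:M + t *: a1) = (1%:M + t *: h) *m b.
          by rewrite mulmxDr mulmxDl mulmx1 mul1mx -scalemxAr -scalemxAl bh.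
        rewrite -!mulmxA -trmx_mul -bt (mulmxA (1%:M + t *: h)) -bt trmx_mul.
        by rewrite !mulmxA.
      rewrite -(mulmxA b); congr (_ *m _ *m _).
      have -> : (1%:M + t *: a1)^T = 1%:M + t *: a1^T by rewrite linearD linearZ /=
        trmx1.
      rewrite /v /w !mulmxDl -!scalemxAl mulmxDl !mulmxKV //.
      rewrite ?(mul1mx, mulmxDr, mulmxDl, mulmx1) -?scalemxAl -?scalemxAr.
      by rewrite !scalerDr scalerA -expr2 !addrA; congr (_ + _); rewrite addrAC.
    by rewrite pfM pfA mulr0.
  (* Both summands of [v] pair with [M] to $\mathrm{tr}(yMa_1)$, so twice this trace is 0. *)
  have := dirM v vso; rewrite Pv dv0 mulmxDr linearD /=.
  have -> : \tr (M *m (a1 *m y)) = \tr (y *m M *m a1).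
    by rewrite mulmxA mxtrace_mulC mulmxA.
  have -> : \tr (M *m (y *m B *m a1^T *m invmx B)) = \tr (y *m M *m a1).
    have e1 : B *m (y^T *m M^T) = y *m M *m B.
      rewrite mulmxA -[B *m y^T]opprK -(so_tr yso) mulNmx (so_trmx B_unit Mso) mulmxN
        opprK.
      by rewrite !mulmxA mulmxK.
    rewrite -mxtrace_tr !trmx_mul trmxK trmx_inv B_sym -!mulmxA e1 mxtrace_mulC.
    by rewrite -!mulmxA mulmxV // mulmx1 mxtrace_mulC mulmxA.
  by rewrite -mulr2n => /esym/eqP; rewrite mulrn_eq0 /= => /eqP.
by apply/matrixP => i j; rewrite [RHS]mxE -mxtrace_mul_delta tr0.
Qed.

(** The direction of [pf_corank2], transported to so(W), has derivative $c\neq 0$. *)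
Lemma pfpoly_gradient_neq0 y M : y \in so_sub B W ->
  (\rank (b *m y *m B *m b^T)).+2 = (r + r)%N -> is_gradient pfpoly y M -> M != 0.
Proof.
move=> yU rkA [MU dirM]; have [yso Py yP] := so_subW yU.
have [e be eb] := exists_section.
have [D skD [c c0 pfD]] := pf_corank2 (form_skew yso) rkA.
have Pe : P *m e = e by rewrite -eb -mulmxA be mulmx1.
pose v := e *m D *m e^T *m invmx B.
have vB : v *m B = e *m D *m e^T by rewrite mulmxKV.
have vso : v \in so B.
  by rewrite so_skew // vB !trmx_mul trmxK skD mulNmx mulmxN mulmxA.
move: v vB vso => v vB vso.
have Pv : P *m v *m P = v.
  apply: (can_inj (mulmxK B_unit)).
  rewrite -(mulmxA (P *m v)) oproj_form // mulmxA -(mulmxA P) vB !mulmxA Pe.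
  by rewrite -!mulmxA -trmx_mul Pe.
apply: contraNneq c0 => M0.
have := dirM v vso; rewrite M0 mul0mx linear0 Pv.
rewrite (@dirderiv_along _ _ _ _ _ ('X * c%:P)) => [|t].
  by rewrite derivM derivX derivC !hornerE => ->.
rewrite -pfD peval_pfpoly.
have -> : b *m (y + t *: v) *m B *m b^T = b *m y *m B *m b^T + t *: D.
  rewrite mulmxDr !mulmxDl -scalemxAr -!scalemxAl; congr (_ + _ *: _).
  by rewrite -(mulmxA b) vB !mulmxA be mul1mx -mulmxA -trmx_mul be trmx1 mulmx1.
rewrite -[RHS]/(horner_eval t _) -map_pf; congr pf.
by apply/matrixP => i j; rewrite !mxE -[RHS]/(horner _ t) !hornerE.
Qed.

End PfaffianInvariant.

(** Independence of the gradients allows the comparison with the given generators; commutation with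
    [y] separates the level from the lower ones. *)
Definition regular_invariants y r (Q : 'I_r -> {mpoly F[n * n]}) (M : 'I_r -> 'M[F]_n)
  : Prop :=
  [/\ forall k, SO_invariant B W (Q k),
      forall k, is_gradient (Q k) y (M k),
      forall k, M k *m y = y *m M k
    & forall c : 'I_r -> F, \sum_k c k *: M k = 0 -> forall k, c k = 0].

End Gradients.

(** * Good invariants at a single level *)

Section Level.
Variables (F : numFieldType) (n' : nat).
Local Notation n := n'.+1.
Variables (B W y : 'M[F]_n) (m r : nat).
Hypotheses (B_sym : B^T = B) (B_unit : B \in unitmx).
Hypothesis W_nondeg : nondegenerate_subspace B W.
Hypotheses (rkW : \rank W = m) (mE : m = (odd m + r.*2)%N).
Hypothesis yU : y \in so_sub B W.
Local Notation P := (oproj B W).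
Hypothesis indep : forall p : {poly F},
  (size p < m)%N -> P *m horner_mx y p = 0 -> p = 0.
Hypothesis corank : (m <= \rank y + 2)%N.

(** Exponents up to $m-2$ are allowed. The offset $t$ is 1 for odd powers, and 0 or 2 after these
    have been divided or multiplied by [y]. *)
Lemma pow_step_independent s t (c : 'I_s -> F) :
  (forall k, c k != 0 -> ((k.*2 + t).+1 < m)%N) ->
  P *m (\sum_k c k *: y ^+ (k.*2 + t)) = 0 -> forall k, c k = 0.
Proof.
move=> ltm Pc k; apply/eqP/negPn/negP => ck; move: (ck) => /negP[].
have m_gt0 : (0 < m)%N by apply: leq_ltn_trans (ltm k ck).
pose p : {poly F} := \sum_k c k *: 'X^(k.*2 + t).
have p0 : p = 0.
  apply: indep.
    rewrite -(prednK m_gt0) ltnS (leq_trans (size_sum _ _ _)) //.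
    apply/bigmax_leqP => i _; have [->|ci] := eqVneq (c i) 0.
      by rewrite scale0r size_poly0.
    by rewrite size_scale // size_polyXn -ltnS prednK // ltm.
  rewrite -[RHS]Pc rmorph_sum /=; congr (_ *m _); apply: eq_bigr => i _.
  by rewrite linearZ /= rmorphXn /= horner_mx_X.
apply/eqP; have := congr1 (fun q : {poly F} => q`_(k.*2 + t)) p0.
rewrite coef0 coef_sum (bigD1 k) //= big1 ?addr0 => [|i nei].
  by rewrite coefZ coefXn eqxx mulr1.
by rewrite coefZ coefXn eqn_add2r -!muln2 eqn_pmul2r // eq_sym (inj_eq val_inj)
  (negbTE nei) mulr0.
Qed.

Let trM k := (k.*2.+2)%:R *: y ^+ k.*2.+1.

Lemma pow_comm k : y ^+ k *m y = y *m y ^+ k.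
Proof. by rewrite mulmxE -exprS -exprSr. Qed.

Lemma mulrSn_eq0 k (c : F) : c * k.+1%:R = 0 -> c = 0.
Proof. by move/eqP; rewrite mulf_eq0 pnatr_eq0 orbF => /eqP. Qed.

Lemma regular_invariants_trace : odd m \/ (exists z, y *m z = P) ->
  regular_invariants B W y (fun k : 'I_r => tracepow F n k.*2.+2) (fun k => trM k).
Proof.
move=> H; split=> [k|k|k|c c0 k].
- exact: tracepow_invariant.
- by apply: tracepow_gradient => //=; rewrite odd_double.
- by rewrite /trM -scalemxAl -scalemxAr pow_comm.
apply: (@mulrSn_eq0 k.*2.+1).
have c0' : \sum_k (c k * (k.*2.+2)%:R) *: y ^+ (k.*2 + 1) = 0.
  by rewrite -[RHS]c0; apply: eq_bigr => i _; rewrite /trM scalerA addn1.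
case: H => [modd | [z yz]].
  (* For odd $m$ the largest exponent is $2r-1=m-2$. *)
  apply: (@pow_step_independent r 1 (fun k => c k * (k.*2.+2)%:R));
    last by rewrite c0' mulmx0.
  by move=> i _; have := ltn_ord i; lia.
(* For even $m$ the exponent $2r-1=m-1$ is too large; the inverse [z] of [y] on [W] lowers it by
   one. *)
apply: (@pow_step_independent r 0 (fun k => c k * (k.*2.+2)%:R)).
  by move=> i _; have := ltn_ord i; lia.
have [_ Py yP] := so_subW B_sym B_unit W_nondeg yU.
transitivity ((\sum_k (c k * (k.*2.+2)%:R) *: y ^+ (k.*2 + 1)) *m z);
  last by rewrite c0' mul0mx.
rewrite mulmx_sumr mulmx_suml; apply: eq_bigr => i _.
rewrite -scalemxAr -scalemxAl; congr (_ *: _).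
rewrite addn0 addn1 exprSr -mulmxE -mulmxA yz.
case: (i : nat) => [|j]; first by rewrite expr0 mulmx1 mul1mx.
rewrite doubleS; transitivity (y ^+ j.*2.+2); first by rewrite exprS -mulmxE mulmxA Py.
by rewrite exprSr -mulmxE -mulmxA yP.
Qed.

Lemma exists_regular_invariants : exists Q M, @regular_invariants F n B W y r Q M.
Proof.
have [modd|meven] := boolP (odd m).
  by eexists; eexists; apply: regular_invariants_trace; left.
have mr : \rank W = (r + r)%N by rewrite rkW mE (negbTE meven) addnn.
have [b b_free eq_b] := exists_row_base mr.
have [uA|nuA] := boolP (b *m y *m B *m b^T \in unitmx).
  eexists; eexists; apply: regular_invariants_trace; right.
  exact: (form_unit B_sym B_unit W_nondeg b_free eq_b yU uA).
have [yso Py yP] := so_subW B_sym B_unit W_nondeg yU.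
have skA := form_skew B_sym b yso.
(* A singular skew form of even size has corank at least 2, and [corank] gives the other bound. *)
have rkA : (\rank (b *m y *m B *m b^T)).+2 = (r + r)%N.
  apply/eqP; rewrite eqn_leq; apply/andP; split.
    rewrite -ltn_predRL ltnNge; apply: contra nuA; exact: skew_unitmx.
  have := rank_le_form B_sym B_unit W_nondeg b_free eq_b yU.
  by move: corank; rewrite -rkW mr => /leq_trans le1 le2; rewrite le1 // addn2 !ltnS.
have [M Mgrad] := gradient_exists B_sym B_unit W_nondeg (pfpoly B b) y.
have yM0 := pfpoly_gradient_mul0 B_sym B_unit W_nondeg b_free eq_b yU nuA Mgrad.
have M0 := pfpoly_gradient_neq0 B_sym B_unit W_nondeg b_free eq_b yU rkA Mgrad.
(* Obtained from $yM=0$ by transposition, both factors being skew for $B$. *)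
have My0 : M *m y = 0.
  have [Mso _ _] := so_subW B_sym B_unit W_nondeg Mgrad.1.
  have h : invmx B *m (M *m y) *m B = 0.
    rewrite -[RHS](trmx0 F n n) -yM0 trmx_mul (so_trmx B_unit Mso) (so_trmx B_unit yso).
    by rewrite mulNmx mulmxN opprK !mulmxA mulmxK.
  by rewrite -[M *m y](mulKVmx B_unit) -[invmx B *m _](mulmxK B_unit) h mul0mx mulmx0.
exists (fun k : 'I_r => if (k.+1 < r)%N then tracepow F n k.*2.+2 else pfpoly B b).
exists (fun k : 'I_r => if (k.+1 < r)%N then trM k else M).
split=> [k|k|k|c c0].
- by case: ifP => _; [apply: tracepow_invariant | apply: pfpoly_invariant].
- case: ifP => _ //; apply: tracepow_gradient => //=; by rewrite odd_double.
- by case: ifP => _; [rewrite /trM -scalemxAl -scalemxAr pow_comm | rewrite yM0 My0].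
have ck (k : 'I_r) : (k.+1 < r)%N -> c k = 0.
  move=> kr; apply: (@mulrSn_eq0 k.*2.+1).
  (* Multiplying the relation by [y] removes [M] and leaves the even powers $2,\dots,2r-2$; the last
     coefficient is set to 0 accordingly. *)
  pose d (k : 'I_r) : F := if (k.+1 < r)%N then c k * (k.*2.+2)%:R else 0.
  have := @pow_step_independent r 2 d; rewrite /d; move/(_ _ _ k); rewrite kr; apply.
    by move=> i; case: ifP => [|_]; [lia | rewrite eqxx].
  transitivity (P *m ((\sum_k c k *: (if (k.+1 < r)%N then trM k else M)) *m y));
    last first.
    by rewrite c0 mul0mx mulmx0.
  rewrite mulmx_suml; congr (_ *m _); apply: eq_bigr => i _.
  case: ifP => _; last by rewrite scale0r -scalemxAl My0 scaler0.
  by rewrite /trM scalerA -scalemxAl mulmxE -exprSr addn2.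
move=> k; have [kr|kr] := boolP (k.+1 < r)%N; first exact: ck.
move: c0; rewrite (bigD1 k) //= (negbTE kr) big1 ?addr0 => [/eqP|i nei].
  by rewrite scaler_eq0 (negbTE M0) orbF => /eqP.
rewrite ck ?scale0r //; move: nei; rewrite -(inj_eq val_inj) /=.
by have := ltn_ord i; have := ltn_ord k; lia.
Qed.

End Level.

(** * Linear independence of the differentials *)

(** Dimension count that transfers freeness from the good invariants to the given generators. *)
Lemma free_span_sub (K : fieldType) (vT : vectType K) (X Y : seq vT) :
  free X -> size X = size Y -> (<<X>> <= <<Y>>)%VS -> free Y /\ (<<X>> = <<Y>>)%VS.
Proof.
move=> freeX szXY sXY; have dimX : \dim <<X>> = size Y by rewrite (eqP freeX).
have eqXY : (<<X>> = <<Y>>)%VS by apply/eqP; rewrite eqEdim sXY dimX dim_span.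
by split=> //; rewrite /free -eqXY dimX.
Qed.

Section Differentials.
Variables (F : numFieldType) (n : nat) (B W x : 'M[F]_n) (r : nat).
Hypotheses (B_sym : B^T = B) (B_unit : B \in unitmx).
Hypothesis W_nondeg : nondegenerate_subspace B W.
Hypothesis x_so : x \in so B.
Local Notation P := (oproj B W).
Local Notation y := (P *m x *m P).
Local Notation d Q := (differential (so B) (pullback (so_proj B W) Q) x).

Lemma differential_pullbackE Q (v : subvs_of (so B)) :
  d Q v = dirderiv Q y (P *m vsval v *m P).
Proof. by rewrite differentialE dirderiv_pullback !so_projE // subvsP. Qed.

Variable psi : 'I_r -> {mpoly F[n * n]}.

Definition level_differentials : seq 'Hom(subvs_of (so B), F^o) :=
  [seq d (psi j) | j <- enum 'I_r].

Lemma size_level_differentials : size level_differentials = r.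
Proof. by rewrite size_map size_enum_ord. Qed.

(** With $Q=p(\psi)$ on so(W), the chain rule gives the coefficients $\partial_j p$ at $\psi(y)$.
    Equality on so(W) is enough, as the lines used stay inside it. *)
Lemma invariant_differential_span Q : invariant_generators B W psi ->
  SO_invariant B W Q -> d Q \in <<level_differentials>>%VS.
Proof.
move=> [_ gen _] /gen [p Qp].
pose a j := (p^`M(j)).@[fun j => peval (psi j) y].
have -> : d Q = \sum_j a j *: d (psi j).
  apply/lfunP => v; rewrite sum_lfunE differential_pullbackE.
  set w := P *m vsval v *m P.
  have wU : w \in so_sub B W by apply: oproj_so => //; apply: subvsP.
  rewrite (@dirderiv_along _ _ _ _ _ (mmap polyC (fun j => mpoly_along (psi j) y w) p)).
    rewrite deriv_mmap horner_sum; apply: eq_bigr => j _.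
    rewrite hornerM horner_mmap scale_lfunE differential_pullbackE.
    congr (_ * _); apply: meval_eq => k.
    by rewrite horner_mpoly_along scale0r addr0.
  move=> t; have wtU : y + t *: w \in so_sub B W by apply: memvD;
    [apply: oproj_so | apply: memvZ].
  rewrite Qp // horner_mmap.
  by apply: meval_eq => j; rewrite horner_mpoly_along.
apply: memv_suml => j _; apply/memvZ/memv_span/map_f.
by rewrite mem_enum.
Qed.

Lemma tr_subvs_eq0 z : z \in so B ->
  (forall v : subvs_of (so B), \tr (z *m vsval v) = 0) -> z = 0.
Proof.
move=> zso H; apply: (tr_so_eq0 B_sym B_unit zso) => v vso.
by rewrite -(vsprojK vso) H.
Qed.

(** Independent gradients make the differentials of the [Q k] free, so they span the same space as
    those of [psi]; hence that span is represented by combinations of the [M k], which commute with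
    [y]. *)
Lemma level_free Q M : invariant_generators B W psi ->
  @regular_invariants F n B W y r Q M ->
  free level_differentials /\
  forall f, f \in <<level_differentials>>%VS ->
    exists N, [/\ N \in so_sub B W, N *m y = y *m N
      & forall v : subvs_of (so B), f v = \tr (N *m vsval v)].
Proof.
move=> gens [Qinv grad comm indepM].
pose Y := [tuple d (Q k) | k < r].
have dE k v : d (Q k) v = \tr (M k *m vsval v).
  by rewrite differential_pullbackE (grad k).2 // subvsP.
have sumE (c : 'I_r -> F) v : (\sum_k c k *: Y`_k) v = \tr
  ((\sum_k c k *: M k) *m vsval v).
  rewrite sum_lfunE mulmx_suml raddf_sum; apply: eq_bigr => k _.
  by rewrite -tnth_nth tnth_mktuple scale_lfunE dE -scalemxAl [RHS]linearZ.
have MU (c : 'I_r -> F) : \sum_k c k *: M k \in so_sub B W.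
  by apply: memv_suml => k _; apply: memvZ; apply: (grad k).1.
have szYL : size Y = size level_differentials.
  exact: etrans (size_tuple Y) (esym size_level_differentials).
have freeY : free Y.
  apply/freeP => c c0; apply: indepM; apply: tr_subvs_eq0 => [|v].
    by have [] := so_subW B_sym B_unit W_nondeg (MU c).
  by rewrite -sumE c0 lfunE.
have sY : (<<Y>> <= <<level_differentials>>)%VS.
  apply/span_subvP => f /mapP[k _ ->]; exact: invariant_differential_span.
have [freeL eqYL] := free_span_sub freeY szYL sY.
split; first exact: freeL.
move=> f; rewrite -eqYL => /coord_span fE.
exists (\sum_k coord Y k f *: M k); split; first exact: MU.
  rewrite mulmx_suml mulmx_sumr; apply: eq_bigr => k _.
  by rewrite -scalemxAl -scalemxAr comm.
by move=> v; rewrite {1}fE sumE.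
Qed.

End Differentials.

(** * Induction along the chain *)

Section Assembly.
Variables (F : numClosedFieldType) (n' : nat).
Local Notation n := n'.+1.
Variables (B : 'M[F]_n) (V : nat -> 'M[F]_n) (x : 'M[F]_n).
Variable psi : forall i : nat, 'I_i./2 -> {mpoly F[n * n]}.
Hypotheses (B_sym : B^T = B) (B_unit : B \in unitmx).
Hypothesis V_chain : nondegenerate_chain B V.
Hypothesis psi_gen : forall i : nat, (1 <= i <= n)%N ->
  invariant_generators B (V i) (@psi i).
Hypothesis x_Theta : so_Theta B V x.

Local Notation P i := (oproj B (V i)).
Local Notation y i := (P i *m x *m P i).
Local Notation L i := (level_differentials B (V i) x (@psi i)).

Lemma chain_nondeg i : (1 <= i <= n)%N -> nondegenerate_subspace B (V i).
Proof. by move=> /V_chain.1 []. Qed.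

Lemma chain_rank i : (1 <= i <= n)%N -> \rank (V i) = i.
Proof. by move=> /V_chain.1 []. Qed.

Lemma chain_small_stable i k (U : 'M[F]_(k, n)) : (1 <= i < n)%N ->
  (U <= V i)%MS -> stablemx U (y i.+1) -> (\rank U <= 1)%N.
Proof.
move=> /andP[i_gt0 i_lt] UV stU.
have i_le : (1 <= i <= n)%N by rewrite i_gt0 ltnW.
(* The spectral condition starts at $i=2$; for $i=1$ the space $V_1$ is itself a line. *)
have [i1|i_ne1] := eqVneq i 1%N.
  by rewrite (leq_trans (mxrankS UV)) // chain_rank // i1.
apply: (rank_common_stable B_sym B_unit (chain_nondeg i_le) (@chain_nondeg i.+1 i_lt)
  _ x_Theta.1 _ UV stU).
  by apply: V_chain.2; rewrite i_gt0.
by apply: x_Theta.2; rewrite i_lt andbT ltn_neqAle eq_sym i_ne1.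
Qed.

Lemma level_regular i : (1 <= i < n)%N ->
  exists Q M, @regular_invariants F n B (V i.+1) (y i.+1) (i.+1)./2 Q M.
Proof.
move=> i_bd; have /andP[i_gt0 i_lt] := i_bd.
have i_le : (1 <= i <= n)%N by rewrite i_gt0 ltnW.
have ndi := chain_nondeg i_le; have ndi1 := @chain_nondeg i.+1 i_lt.
have sV : (V i <= V i.+1)%MS by apply: V_chain.2.
have rki : (\rank (V i)).+1 = i.+1 by rewrite chain_rank.
have rki1 : \rank (V i.+1) = i.+1 by rewrite chain_rank.
have yiU : y i.+1 \in so_sub B (V i.+1) by apply: oproj_so => //; apply: x_Theta.1.
have small k (U : 'M_(k, n)) := @chain_small_stable i k U i_bd.
apply: (exists_regular_invariants _ _ _ rki1 _ yiU) => //.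
- by rewrite odd_double_half.
- exact: (pow_independent B_sym B_unit ndi ndi1 sV rki rki1 yiU small).
- exact: (corank_le2 B_sym B_unit ndi ndi1 sV rki rki1 yiU small).
Qed.

Lemma so_sub_chain i z : (1 <= i < n)%N -> z \in so_sub B (V i) -> z \in so_sub B
  (V i.+1).
Proof.
move=> i_bd; have /andP[i_gt0 i_lt] := i_bd.
have ndi : nondegenerate_subspace B (V i) by apply: chain_nondeg; rewrite i_gt0 ltnW.
have ndi1 := @chain_nondeg i.+1 i_lt.
rewrite !mem_so_subE // => /andP[-> /eqP Pz] /=.
have sV : (V i <= V i.+1)%MS by apply: V_chain.2.
by rewrite -Pz mulmxA (oprojMr B_sym B_unit ndi ndi1 sV).
Qed.

(** The induction also carries representatives in so(V_m), needed to compare the span with that of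
    the next level. *)
Lemma differentials_free m : (1 <= m <= n)%N ->
  free (flatten [seq L i | i <- iota 1 m]) /\
  forall f, f \in <<flatten [seq L i | i <- iota 1 m]>>%VS ->
    exists2 N, N \in so_sub B (V m)
      & forall v : subvs_of (so B), f v = \tr (N *m vsval v).
Proof.
elim: m => // -[_ _|m IHm /andP[_ m_le]].
  (* so(1) has rank 0 and contributes no generators. *)
  have -> : flatten [seq L i | i <- iota 1 1] = [::].
    by rewrite /= cats0; apply: size0nil; rewrite size_map size_enum_ord.
  split=> [|f]; first exact: nil_free.
  rewrite span_nil memv0 => /eqP->; exists 0; first exact: mem0v.
  by move=> v; rewrite mul0mx linear0 lfunE.
have m_bd : (1 <= m.+1 < n)%N by [].
have [freeL reprL] := IHm (ltnW m_le).
have [Q [M regQM]] := level_regular m_bd.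
have ndm1 := @chain_nondeg m.+2 m_le.
have [freeL' reprL'] := level_free B_sym B_unit ndm1 x_Theta.1 (@psi_gen m.+2 m_le)
  regQM.
have -> : flatten [seq L i | i <- iota 1 m.+2] =
    flatten [seq L i | i <- iota 1 m.+1] ++ L m.+2.
  have -> : iota 1 m.+2 = iota 1 m.+1 ++ [:: m.+2] by rewrite -(iotaD 1 m.+1 1) addn1.
  by rewrite map_cat flatten_cat; congr (_ ++ _); apply: cats0.
set X := flatten _ in freeL reprL *.
have ndm := @chain_nondeg m.+1 (ltnW m_le).
split.
  rewrite cat_free freeL freeL' /=; apply/directv_addP/eqP; rewrite -subv0.
  apply/subvP => f; rewrite memv_cap => /andP[/reprL [N NU fN] /reprL'
    [N' [N'U N'y fN']]].
  (* A functional common to both spans has a representative in the smaller algebra and one commuting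
     with the new component of $x$. They coincide, so [centralizer_eq0] applies. *)
  have NN' : N = N'.
    apply/eqP; rewrite -subr_eq0; apply/eqP.
    apply: (@tr_subvs_eq0 _ _ _ B_sym B_unit) => [|v].
      have [Nso _ _] := so_subW B_sym B_unit ndm NU.
      have [N'so _ _] := so_subW B_sym B_unit ndm1 N'U.
      exact: memvB.
    by rewrite mulmxBl linearB /= -fN -fN' subrr.
  have N0 : N = 0.
    apply: (@centralizer_eq0 _ _ B (V m.+1) (y m.+2)) => //; last by rewrite NN'.
    by move=> k U; apply: chain_small_stable.
  rewrite memv0; apply/eqP/lfunP => v.
  by rewrite fN N0 mul0mx linear0 lfunE.
move=> f; rewrite span_cat => /memv_addP[f1 /reprL[N1 N1U f1N]
  [f2 /reprL'[N2 [N2U _ f2N]] ->]].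
exists (N1 + N2); first by rewrite rpredD // so_sub_chain.
by move=> v; rewrite add_lfunE f1N f2N mulmxDl linearD.
Qed.

End Assembly.

Theorem proposition4p18 (R : realType) (n : nat) (B : 'M[complex R]_n)
    (V : nat -> 'M[complex R]_n)
    (psi : forall i : nat, 'I_i./2 -> {mpoly (complex R)[n * n]})
    (n_gt0 : (0 < n)%N)
    (B_sym : B^T = B) (B_nondeg : B \in unitmx)
    (V_chain : nondegenerate_chain B V)
    (psi_gen : forall i : nat, (1 <= i <= n)%N ->
       invariant_generators B (V i) (psi i)) :
  forall x : 'M[complex R]_n, so_Theta B V x -> strongly_regular B V psi x.
Proof.
case: n B V psi n_gt0 B_sym B_nondeg V_chain psi_gen => // n B V psi _ B_sym B_unit
  chain gens x xTheta.
by have [] := differentials_free B_sym B_unit chain gens xTheta (m := n.+1) (leqnn _).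
Qed.
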